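(* Let $k$ be an algebraically closed field and $\Lambda$ an indecomposable finite dimensional $k$-algebra. Let $\{\eta_1,\ldots,\eta_t\}$ be a finite set of homogeneous elements in $\mathrm{HH}^*(\Lambda)$, and let $M$ be a finitely generated left $\Lambda$-module. Let $A_{\mathrm{HH}^*(\Lambda)}(M,M)$ be the annihilator of $\mathrm{Ext}^*_\Lambda(M,M)$ in $\mathrm{HH}^*(\Lambda)$. (a) The following are equivalent: (i) the ideal generated by $\{\eta_1,\ldots,\eta_t\}$ is contained in $A_{\mathrm{HH}^*(\Lambda)}(M,M)$; (ii) $\mathcal{E}_{\eta_i}\otimes_\Lambda M$ is a split short exact sequence for all $i=1,2,\ldots,t$; (iii) $\mathcal{E}_{\eta_1,\ldots,\eta_t}\otimes_\Lambda M$ is a split short exact sequence. (b) If a finite set $\{\eta_1,\ldots,\eta_t\}$ of homogeneous elements in $\mathrm{HH}^*(\Lambda)$ is in $A_{\mathrm{HH}^*(\Lambda)}(M,M)$, then $M$ is a direct summand of $M_{\eta_1}\otimes_\Lambda\cdots\otimes_\Lambda M_{\eta_t}\otimes_\Lambda M$.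
   Context: $\Lambda^e=\Lambda\otimes_k\Lambda^{\mathrm{op}}$; $\Lambda$-bimodules are viewed as left $\Lambda^e$-modules; $\mathrm{HH}^*(\Lambda)=\bigoplus_{i\ge 0}\mathrm{Ext}^i_{\Lambda^e}(\Lambda,\Lambda)$. $\mathrm{Ext}^*_\Lambda(M,M)=\bigoplus_{i\ge0}\mathrm{Ext}^i_\Lambda(M,M)$ is an $\mathrm{HH}^*(\Lambda)$-module via the graded ring homomorphism $\mathrm{HH}^*(\Lambda)\to\mathrm{Ext}^*_\Lambda(M,M)$ induced by $-\otimes_\Lambda M$. Let $\cdots\to P^1\to P^0\to\Lambda\to 0$ be a minimal projective resolution of $\Lambda$ as a $\Lambda^e$-module, with syzygies $\Omega^i_{\Lambda^e}(\Lambda)$. For a homogeneous element $\eta$ of degree $n$ represented by a map $\eta\colon\Omega^n_{\Lambda^e}(\Lambda)\to\Lambda$, the sequence $\mathcal{E}_\eta\colon 0\to\Lambda\xrightarrow{\alpha_\eta}M_\eta\xrightarrow{\beta_\eta}\Omega^{n-1}_{\Lambda^e}(\Lambda)\to 0$ is the pushout of $0\to\Omega^n_{\Lambda^e}(\Lambda)\to P^{n-1}\to\Omega^{n-1}_{\Lambda^e}(\Lambda)\to 0$ along $\eta$; this defines the bimodule $M_\eta$ (its isomorphism class is independent of the representative), which is projective as a left and as a right $\Lambda$-module. For $\eta_1,\ldots,\eta_t$, the map $\alpha_{\eta_1,\ldots,\eta_t}=\alpha_{\eta_1}\otimes\cdots\otimes\alpha_{\eta_t}\colon\Lambda\simeq\Lambda\otimes_\Lambda\cdots\otimes_\Lambda\Lambda\to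 M_{\eta_1}\otimes_\Lambda\cdots\otimes_\Lambda M_{\eta_t}$ is a monomorphism, and $\mathcal{E}_{\eta_1,\ldots,\eta_t}$ is the exact sequence $0\to\Lambda\xrightarrow{\alpha_{\eta_1,\ldots,\eta_t}}M_{\eta_1}\otimes_\Lambda\cdots\otimes_\Lambda M_{\eta_t}\to X_{\eta_1,\ldots,\eta_t}\to 0$, where $X_{\eta_1,\ldots,\eta_t}$ is the cokernel. *)

(* Defs.v *)
From HB Require Import structures.
From mathcomp Require Import all_boot all_algebra all_field.
From mathcomp Require Import boolp classical_sets.

Set Implicit Arguments.
Unset Strict Implicit.
Unset Printing Implicit Defensive.

Import GRing.Theory.
Local Open Scope ring_scope.
Local Open Scope quotient_scope.

Lemma morphD0 (U V : zmodType) (f : U -> V) : {morph f : x y / x + y} -> f 0 = 0.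
Proof. by move=> fD; apply: (@addIr _ (f 0)); rewrite -fD !add0r. Qed.

(* The tensor product of M (right action ra) and N (left action la): formal
   sums of pairs, two of them being identified when every balanced map takes
   the same value on them.  tlift, tlift_pure and tens_ind give its universal
   property; lifts are evaluated on a representative and are meaningful for
   balanced maps only. *)
Section Tensor.
Variables (S : Type) (M N : zmodType) (ra : M -> S -> M) (la : S -> N -> N).

Definition balanced (G : zmodType) (f : M -> N -> G) : Prop :=
  [/\ forall m m' n, f (m + m') n = f m n + f m' n,
      forall m n n', f m (n + n') = f m n + f m n'
    & forall m c n, f (ra m c) n = f m (la c n)].

Definition tens_sum (G : zmodType) (f : M -> N -> G) (s : seq (M * N)) : G :=
  \sum_(p <- s) f p.1 p.2.

Definition tens_eq (s t : seq (M * N)) : bool :=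
  `[< forall (G : zmodType) (f : M -> N -> G),
        balanced f -> tens_sum f s = tens_sum f t >].

Lemma tens_eq_refl : reflexive tens_eq.
Proof. by move=> s; apply/asboolP. Qed.

Lemma tens_eq_sym : symmetric tens_eq.
Proof.
by move=> s t; apply/asboolP/asboolP => h G f bf; rewrite (h G f bf).
Qed.

Lemma tens_eq_trans : transitive tens_eq.
Proof.
move=> t s u /asboolP h1 /asboolP h2; apply/asboolP => G f bf.
by rewrite (h1 G f bf) (h2 G f bf).
Qed.

Canonical tens_equiv := EquivRel tens_eq tens_eq_refl tens_eq_sym tens_eq_trans.

Definition tens := {eq_quot tens_eq}.
HB.instance Definition _ := Choice.on tens.

Definition tpure (m : M) (n : N) : tens := \pi_({eq_quot tens_eq}) [:: (m, n)].

Definition tlift (G : zmodType) (f : M -> N -> G) (t : tens) : G :=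
  tens_sum f (repr (t : {eq_quot tens_eq})).

Let tpi (s : seq (M * N)) : tens := \pi_({eq_quot tens_eq}) s.

Lemma tlift_pi (G : zmodType) (f : M -> N -> G) s : balanced f ->
  tlift f (tpi s) = tens_sum f s.
Proof.
move=> bf; rewrite /tlift /tpi.
have /eqmodP/asboolP -> // : repr (\pi_({eq_quot tens_eq}) s) = s %[mod {eq_quot tens_eq}].
by rewrite reprK.
Qed.

Lemma tens_ext (t u : tens) :
  (forall (G : zmodType) (f : M -> N -> G), balanced f -> tlift f t = tlift f u) ->
  t = u.
Proof.
move=> h; rewrite -[t]reprK -[u]reprK; apply/eqmodP/asboolP => G f bf.
exact: h.
Qed.

Let tzero : tens := tpi [::].
Let tadd (t u : tens) : tens :=
  tpi (repr (t : {eq_quot tens_eq}) ++ repr (u : {eq_quot tens_eq})).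
Let topp (t : tens) : tens :=
  tpi [seq (- p.1, p.2) | p <- repr (t : {eq_quot tens_eq})].

Lemma balanced0l (G : zmodType) (f : M -> N -> G) n : balanced f -> f 0 n = 0.
Proof. by case=> h _ _; apply: (morphD0 (f := f^~ n)) => m m'; exact: h. Qed.

Lemma balancedNl (G : zmodType) (f : M -> N -> G) m n :
  balanced f -> f (- m) n = - f m n.
Proof.
move=> bf; apply/eqP; rewrite -addr_eq0; case: (bf) => h _ _.
by rewrite -h addNr balanced0l.
Qed.

Let tlift0 (G : zmodType) (f : M -> N -> G) : balanced f -> tlift f tzero = 0.
Proof. by move=> bf; rewrite tlift_pi // /tens_sum big_nil. Qed.

Let tliftD (G : zmodType) (f : M -> N -> G) t u : balanced f ->
  tlift f (tadd t u) = tlift f t + tlift f u.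
Proof. by move=> bf; rewrite tlift_pi // /tens_sum big_cat. Qed.

Let tliftN (G : zmodType) (f : M -> N -> G) t : balanced f ->
  tlift f (topp t) = - tlift f t.
Proof.
move=> bf; rewrite tlift_pi // /tens_sum big_map -sumrN.
by apply: eq_bigr => p _ /=; rewrite balancedNl.
Qed.

Let taddA : associative tadd.
Proof. by move=> t u v; apply: tens_ext => G f bf; rewrite !tliftD // addrA. Qed.
Let taddC : commutative tadd.
Proof. by move=> t u; apply: tens_ext => G f bf; rewrite !tliftD // addrC. Qed.
Let tadd0 : left_id tzero tadd.
Proof. by move=> t; apply: tens_ext => G f bf; rewrite tliftD // tlift0 // add0r. Qed.
Let taddN : left_inverse tzero topp tadd.
Proof.
by move=> t; apply: tens_ext => G f bf; rewrite tliftD // tliftN // addNr tlift0.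
Qed.

HB.instance Definition _ := GRing.isZmodule.Build tens taddA taddC tadd0 taddN.

Lemma tlift_is_additive (G : zmodType) (f : M -> N -> G) : balanced f ->
  {morph tlift f : t u / t + u}.
Proof. by move=> bf t u; exact: tliftD. Qed.

Lemma tlift_pure (G : zmodType) (f : M -> N -> G) m n : balanced f ->
  tlift f (tpure m n) = f m n.
Proof. by move=> bf; rewrite tlift_pi // /tens_sum big_seq1. Qed.

Lemma tpure_balanced : balanced tpure.
Proof.
split=> [m m' n|m n n'|m c n]; apply: tens_ext => G f bf;
  rewrite ?tlift_is_additive // !tlift_pure //; by case: (bf).
Qed.

Lemma tens_ind (Q : tens -> Prop) :
  Q 0 -> (forall m n, Q (tpure m n)) ->
  (forall t u, Q t -> Q u -> Q (t + u)) -> forall t, Q t.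
Proof.
move=> Q0 Q1 QD t; rewrite -[t]reprK; elim: (repr _) => [|[m n] s IH] //.
suff -> : (\pi_({eq_quot tens_eq}) ((m, n) :: s) : tens)
  = tpure m n + (\pi_({eq_quot tens_eq}) s : tens) by exact: QD.
apply: tens_ext => G f bf; rewrite tlift_is_additive // tlift_pure // !tlift_pi //.
by rewrite /tens_sum big_cons.
Qed.

Lemma tens_morph_ext (G : zmodType) (f g : tens -> G) :
  {morph f : t u / t + u} -> {morph g : t u / t + u} ->
  (forall m n, f (tpure m n) = g (tpure m n)) -> f =1 g.
Proof.
move=> fD gD e; elim/tens_ind => // [|t u]; last by rewrite fD gD => -> ->.
by rewrite (morphD0 fD) (morphD0 gD).
Qed.

End Tensor.

Section TensorExtra.
Variables (S : Type) (M N : zmodType) (ra : M -> S -> M) (la : S -> N -> N).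
Local Notation T := (tens ra la).

Lemma tpureDl m m' n : tpure ra la (m + m') n = tpure ra la m n + tpure ra la m' n.
Proof. by case: (tpure_balanced ra la). Qed.
Lemma tpureDr m n n' : tpure ra la m (n + n') = tpure ra la m n + tpure ra la m n'.
Proof. by case: (tpure_balanced ra la). Qed.
Lemma tpureA m c n : tpure ra la (ra m c) n = tpure ra la m (la c n).
Proof. by case: (tpure_balanced ra la). Qed.

Lemma tliftDf (G : zmodType) (f g h : M -> N -> G) (t : T) :
  balanced ra la f -> balanced ra la g -> balanced ra la h ->
  (forall m n, f m n = g m n + h m n) -> tlift f t = tlift g t + tlift h t.
Proof.
move=> bf bg bh e; elim/tens_ind: t => [|m n|t u]; rewrite ?tlift_is_additive ?tlift_pure //.
  by rewrite !(morphD0 (tlift_is_additive _)) // addr0.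
by move=> -> ->; rewrite addrACA.
Qed.

Lemma tlift_eq (G : zmodType) (f g : M -> N -> G) (t : T) :
  balanced ra la f -> balanced ra la g ->
  (forall m n, f m n = g m n) -> tlift f t = tlift g t.
Proof.
by move=> bf bg e; move: t; apply: tens_morph_ext => [||m n];
  rewrite ?tlift_pure //; exact: tlift_is_additive.
Qed.
End TensorExtra.

(* The enveloping algebra L (x)_k L^op as a ring; epure a b is a (x) b, and
   the second factor is multiplied in the opposite order.  A bimodule (with k
   acting centrally) is an lmodType over it. *)
Section Enveloping.
Variables (k : fieldType) (L : algType k).

Definition env : Type :=
  tens (fun (a : L) (c : k) => c *: a) (fun (c : k) (b : L) => c *: b).
HB.instance Definition _ := GRing.Zmodule.on env.

Definition epure (a b : L) : env := tpure _ _ a b.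

Definition elift (G : zmodType) (f : L -> L -> G) (t : env) : G :=
  @tlift k L L _ _ G f t.

Definition ebalanced (G : zmodType) (f : L -> L -> G) : Prop :=
  @balanced k L L (fun (a : L) (c : k) => c *: a) (fun (c : k) (b : L) => c *: b) G f.

Lemma eliftD (G : zmodType) (f : L -> L -> G) : ebalanced f ->
  {morph elift f : t u / t + u}.
Proof. by move=> bf t u; exact: tlift_is_additive. Qed.

Lemma elift_pure (G : zmodType) (f : L -> L -> G) a b : ebalanced f ->
  elift f (epure a b) = f a b.
Proof. exact: tlift_pure. Qed.

Lemma eliftDf (G : zmodType) (f g h : L -> L -> G) t :
  ebalanced f -> ebalanced g -> ebalanced h ->
  (forall m n, f m n = g m n + h m n) -> elift f t = elift g t + elift h t.
Proof. exact: tliftDf. Qed.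

Lemma elift_eq (G : zmodType) (f g : L -> L -> G) t :
  ebalanced f -> ebalanced g ->
  (forall m n, f m n = g m n) -> elift f t = elift g t.
Proof. exact: tlift_eq. Qed.

Definition emul (t u : env) : env :=
  elift (fun a b => elift (fun a' b' => epure (a * a') (b' * b)) u) t.

Lemma epureDl a a' b : epure (a + a') b = epure a b + epure a' b.
Proof. exact: tpureDl. Qed.
Lemma epureDr a b b' : epure a (b + b') = epure a b + epure a b'.
Proof. exact: tpureDr. Qed.
Lemma epureZ c a b : epure (c *: a) b = epure a (c *: b).
Proof. exact: (tpureA (fun (a : L) (c : k) => c *: a)). Qed.

Let emul_bal2 (a b : L) : ebalanced (fun a' b' => epure (a * a') (b' * b)).
Proof.
split=> [x y z|x y z|x c z]; rewrite ?mulrDr ?mulrDl ?epureDl ?epureDr //.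
by rewrite -scalerAr epureZ scalerAl.
Qed.

Let emul_bal1 u : ebalanced (fun a b => elift (fun a' b' => epure (a * a') (b' * b)) u).
Proof.
split=> [a a' b|a b b'|a c b].
- by apply: eliftDf; try exact: emul_bal2; move=> x y; rewrite mulrDl epureDl.
- by apply: eliftDf; try exact: emul_bal2; move=> x y; rewrite mulrDr epureDr.
- apply: elift_eq; try exact: emul_bal2.
  by move=> x y; rewrite -scalerAl epureZ scalerAr.
Qed.

Lemma emul_pure a b a' b' : emul (epure a b) (epure a' b') = epure (a * a') (b' * b).
Proof. by rewrite /emul !elift_pure. Qed.

Let emulDl : left_distributive emul +%R.
Proof. by move=> t u v; rewrite /emul eliftD. Qed.

Let emulDr : right_distributive emul +%R.
Proof.
move=> t u v; rewrite /emul; apply: eliftDf => // m n.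
by rewrite eliftD.
Qed.

Lemma env_ind (Q : env -> Prop) :
  (forall a b, Q (epure a b)) -> (forall t u, Q t -> Q u -> Q (t + u)) ->
  forall t, Q t.
Proof.
move=> Q1 QD; apply: tens_ind => //.
suff <- : epure 0 0 = 0 by [].
by rewrite (morphD0 (f := epure^~ 0)) // => x y; rewrite epureDl.
Qed.

Let emulA : associative emul.
Proof.
move=> t u v; elim/env_ind: t => [a b|t t' IH IH']; last by rewrite !emulDl IH IH'.
elim/env_ind: u => [a1 b1|u u' IH IH']; last by rewrite !(emulDl, emulDr) IH IH'.
elim/env_ind: v => [a2 b2|v v' IH IH']; last by rewrite !emulDr IH IH'.
by rewrite !emul_pure !mulrA.
Qed.

Let emul1 : left_id (epure 1 1) emul.
Proof.
elim/env_ind => [a b|t u IH IH']; last by rewrite emulDr IH IH'.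
by rewrite emul_pure mul1r mulr1.
Qed.

Let emulr1 : right_id (epure 1 1) emul.
Proof.
elim/env_ind => [a b|t u IH IH']; last by rewrite emulDl IH IH'.
by rewrite emul_pure mul1r mulr1.
Qed.

HB.instance Definition _ :=
  GRing.Zmodule_isPzRing.Build env emulA emul1 emulr1 emulDl emulDr.

Lemma epureM a b a' b' : epure a b * epure a' b' = epure (a * a') (b' * b).
Proof. exact: emul_pure. Qed.
Lemma epure1 : epure 1 1 = 1. Proof. by []. Qed.
End Enveloping.

Definition mklin (A : pzRingType) (U V : lmodType A) (f : U -> V)
    (fl : linear f) : {linear U -> V} :=
  HB.pack f (GRing.isLinear.Build A U V *:%R f fl).

Section Cokernel.
Variables (A : pzRingType) (U V : lmodType A) (f : {linear U -> V}).

Definition cok_eq (x y : V) : bool := `[< exists u : U, x - y = f u >].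

Lemma cok_eq_refl : reflexive cok_eq.
Proof. by move=> x; apply/asboolP; exists 0; rewrite subrr linear0. Qed.
Lemma cok_eq_sym : symmetric cok_eq.
Proof.
by move=> x y; apply/asboolP/asboolP => -[u e]; exists (- u); rewrite linearN -e opprB.
Qed.
Lemma cok_eq_trans : transitive cok_eq.
Proof.
move=> y x z /asboolP[u e] /asboolP[v e']; apply/asboolP; exists (u + v).
by rewrite linearD -e -e' addrA subrK.
Qed.
Canonical cok_equiv := EquivRel cok_eq cok_eq_refl cok_eq_sym cok_eq_trans.

Definition cok := {eq_quot cok_eq}.
HB.instance Definition _ := Choice.on cok.

Let pi (x : V) : cok := \pi_({eq_quot cok_eq}) x.
Let rp (q : cok) : V := repr (q : {eq_quot cok_eq}).

Let rpK q : pi (rp q) = q. Proof. exact: reprK. Qed.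

Let piP x y : pi x = pi y <-> exists u, x - y = f u.
Proof. by split=> [/eqmodP/asboolP|e] //; apply/eqmodP/asboolP. Qed.

Let rpP x : exists u, rp (pi x) - x = f u.
Proof. by apply/piP; rewrite rpK. Qed.

Let cadd p q := pi (rp p + rp q).
Let copp p := pi (- rp p).
Let cscale a p := pi (a *: rp p).

Let piD x y : pi (x + y) = cadd (pi x) (pi y).
Proof.
apply/piP; have [u e] := rpP x; have [v e'] := rpP y; exists (- (u + v)).
by rewrite linearN linearD -e -e' [in RHS]addrACA -opprD opprB.
Qed.
Let piN x : pi (- x) = copp (pi x).
Proof.
by apply/piP; have [u e] := rpP x; exists u; rewrite -e opprK addrC.
Qed.
Let piZ a x : pi (a *: x) = cscale a (pi x).
Proof.
apply/piP; have [u e] := rpP x; exists (- (a *: u)).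
by rewrite linearN linearZ_LR -e scalerBr opprB.
Qed.

Let caddA : associative cadd.
Proof. by move=> p q r; rewrite -(rpK p) -(rpK q) -(rpK r) -!piD addrA. Qed.
Let caddC : commutative cadd.
Proof. by move=> p q; rewrite -(rpK p) -(rpK q) -!piD addrC. Qed.
Let cadd0 : left_id (pi 0) cadd.
Proof. by move=> p; rewrite -(rpK p) -!piD add0r. Qed.
Let caddN : left_inverse (pi 0) copp cadd.
Proof. by move=> p; rewrite -(rpK p) -piN -!piD addNr. Qed.

HB.instance Definition _ := GRing.isZmodule.Build cok caddA caddC cadd0 caddN.

Let cscaleA a b p : cscale a (cscale b p) = cscale (a * b) p.
Proof. by rewrite -(rpK p) -!piZ scalerA. Qed.
Let cscale1 : left_id 1 cscale.
Proof. by move=> p; rewrite -(rpK p) -!piZ scale1r. Qed.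
Let cscaleDr : right_distributive cscale +%R.
Proof.
move=> a p q; rewrite -(rpK p) -(rpK q) -[pi _ + pi _]piD -!piZ scalerDr.
exact: piD.
Qed.
Let cscaleDl p : {morph cscale^~ p : a b / a + b}.
Proof. by move=> a b; rewrite -(rpK p) -!piZ scalerDl; exact: piD. Qed.

HB.instance Definition _ :=
  GRing.Zmodule_isLmodule.Build A cok cscaleA cscale1 cscaleDr cscaleDl.

Definition cok_proj_fun (x : V) : cok := \pi_({eq_quot cok_eq}) x.

Let cok_proj_linear : linear cok_proj_fun.
Proof. by move=> a x y; rewrite /cok_proj_fun [LHS]piD piZ. Qed.

Definition cok_proj : {linear V -> cok} := mklin cok_proj_linear.

Lemma cok_projP x y : cok_proj x = cok_proj y <-> exists u, x - y = f u.
Proof. exact: piP. Qed.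

Lemma cok_surj (q : cok) : exists x, cok_proj x = q.
Proof. by exists (rp q); exact: rpK. Qed.

Section Lift.
Variables (W : lmodType A) (g : {linear V -> W}) (gf0 : forall u, g (f u) = 0).

Let cok_lift_fun (q : cok) : W := g (rp q).

Let cok_lift_pi x : cok_lift_fun (pi x) = g x.
Proof.
have [u e] := rpP x; apply/eqP; rewrite -subr_eq0 /cok_lift_fun -linearB e.
by rewrite gf0.
Qed.

Let cok_lift_linear : linear cok_lift_fun.
Proof.
move=> a p q; rewrite -(rpK p) -(rpK q) -[a *: _]piZ -[_ + _]piD !cok_lift_pi.
exact: linearP.
Qed.

Definition cok_lift : {linear cok -> W} := mklin cok_lift_linear.

Lemma cok_liftE x : cok_lift (cok_proj x) = g x.
Proof. exact: cok_lift_pi. Qed.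
End Lift.
End Cokernel.

(* Commuting left and right L-actions that agree on k define a left
   env-module. *)
Section BimoduleActions.
Variables (k : fieldType) (L : algType k) (Z : zmodType).
Variables (la : L -> Z -> Z) (ra : Z -> L -> Z).

Record bimod_axioms : Prop := BimodAxioms {
  laDr : forall a, {morph la a : x y / x + y};
  laDl : forall x, {morph la^~ x : a b / a + b};
  laM : forall a b x, la (a * b) x = la a (la b x);
  la1 : forall x, la 1 x = x;
  raDl : forall b, {morph ra^~ b : x y / x + y};
  raDr : forall x, {morph ra x : a b / a + b};
  raM : forall x a b, ra x (a * b) = ra (ra x a) b;
  ra1 : forall x, ra x 1 = x;
  laraA : forall a x b, la a (ra x b) = ra (la a x) b;
  laraZ : forall (c : k) x, la (c *: 1) x = ra x (c *: 1) }.

Hypothesis ax : bimod_axioms.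

Definition bscale (t : env L) (x : Z) : Z := elift (fun a b => la a (ra x b)) t.


Let laZ c a x : la (c *: a) x = la a (ra x (c *: 1)).
Proof.
rewrite -[a in LHS]mulr1 scalerAr (laM ax) (laraZ ax) //.
Qed.

Let raZ c b x : ra x (c *: b) = ra (ra x (c *: 1)) b.
Proof. by rewrite -(raM ax) -scalerAl mul1r. Qed.

Lemma bscale_balanced x : ebalanced (fun a b => la a (ra x b)).
Proof.
split=> [a a' b|a b b'|a c b]; rewrite ?(laDl ax) ?(raDr ax) ?(laDr ax) //.
by rewrite laZ [in RHS]raZ -!(raM ax) -scalerAl -scalerAr mul1r mulr1.
Qed.

Lemma bscale_pure a b x : bscale (epure a b) x = la a (ra x b).
Proof. by rewrite /bscale elift_pure //; exact: bscale_balanced. Qed.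

Lemma bscaleDl x : {morph bscale^~ x : t u / t + u}.
Proof. exact: eliftD (bscale_balanced x). Qed.

Lemma bscaleDr : right_distributive bscale +%R.
Proof.
move=> t x y; apply: eliftDf; try exact: bscale_balanced.
by move=> a b; rewrite (raDl ax) (laDr ax).
Qed.

Lemma bscaleA t u x : bscale t (bscale u x) = bscale (t * u) x.
Proof.
elim/env_ind: t => [a b|t t' IH IH']; last by rewrite mulrDl !bscaleDl IH IH'.
elim/env_ind: u => [c d|u u' IH IH']; last first.
  by rewrite mulrDr !bscaleDl bscaleDr IH IH'.
by rewrite epureM !bscale_pure (raM ax) (laM ax) !(laraA ax).
Qed.

Lemma bscale1 : left_id 1 bscale.
Proof. by move=> x; rewrite -epure1 bscale_pure (ra1 ax) (la1 ax). Qed.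

End BimoduleActions.

Section RestrictedActions.
Variables (k : fieldType) (L : algType k).

Definition blact (X : lmodType (env L)) (a : L) (x : X) : X := epure a 1 *: x.
Definition bract (X : lmodType (env L)) (x : X) (b : L) : X := epure 1 b *: x.

Lemma bimod_actions (X : lmodType (env L)) : bimod_axioms (@blact X) (@bract X).
Proof.
rewrite /blact /bract.
split=> [a x y|x a b|a b x|x|b x y|x a b|x a b|x|a x b|c x] /=.
- by rewrite scalerDr.
- by rewrite -scalerDl -epureDl.
- by rewrite scalerA epureM mulr1.
- by rewrite epure1 scale1r.
- by rewrite scalerDr.
- by rewrite -scalerDl -epureDr.
- by rewrite scalerA epureM mulr1.
- by rewrite epure1 scale1r.
- by rewrite !scalerA !epureM !mulr1 !mul1r.
- by rewrite epureZ.
Qed.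

Lemma epureE (X : lmodType (env L)) a b (x : X) :
  epure a b *: x = blact a (bract x b).
Proof. by rewrite /blact /bract scalerA epureM mulr1 mulr1. Qed.

(* L as a bimodule: epure a b *: x = a * x * b. *)
Definition breg : Type := L.
HB.instance Definition _ := GRing.Zmodule.on breg.

Lemma breg_axioms : @bimod_axioms k L breg (fun a x => a * x) (fun x b => x * b).
Proof.
split=> [a x y|x a b|a b x|x|b x y|x a b|x a b|x|a x b|c x] /=;
  rewrite ?mulrDr ?mulrDl ?mulrA ?mulr1 ?mul1r //.
by rewrite -scalerAl -scalerAr mul1r mulr1.
Qed.

HB.instance Definition _ := GRing.Zmodule_isLmodule.Build (env L) breg
  (bscaleA breg_axioms) (bscale1 breg_axioms) (bscaleDr breg_axioms)
  (bscaleDl breg_axioms).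

Lemma breg_scale a b (x : breg) : epure a b *: x = (a * (x * b) : L).
Proof. exact: (bscale_pure breg_axioms). Qed.
End RestrictedActions.

(* X (x)_L M as a left L-module, for a bimodule X. *)
Section ModuleTensor.
Variables (k : fieldType) (L : algType k) (X : lmodType (env L)) (M : lmodType L).

Definition mtens : Type :=
  tens (fun (x : X) (a : L) => bract x a) (fun (a : L) (m : M) => a *: m).
HB.instance Definition _ := GRing.Zmodule.on mtens.

Definition mpure (x : X) (m : M) : mtens := tpure _ _ x m.

Definition mbalanced (G : zmodType) (f : X -> M -> G) : Prop :=
  balanced (fun (x : X) (a : L) => bract x a) (fun (a : L) (m : M) => a *: m) f.

Definition mlift (G : zmodType) (f : X -> M -> G) (t : mtens) : G :=
  @tlift L X M _ _ G f t.

Lemma mpure_balanced : mbalanced mpure. Proof. exact: tpure_balanced. Qed.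
Lemma mliftD (G : zmodType) (f : X -> M -> G) : mbalanced f ->
  {morph mlift f : t u / t + u}.
Proof. by move=> bf t u; exact: tlift_is_additive. Qed.
Lemma mlift_pure (G : zmodType) (f : X -> M -> G) x m : mbalanced f ->
  mlift f (mpure x m) = f x m.
Proof. exact: tlift_pure. Qed.

Lemma mpureDl x y m : mpure (x + y) m = mpure x m + mpure y m.
Proof. by case: mpure_balanced. Qed.
Lemma mpureDr x m n : mpure x (m + n) = mpure x m + mpure x n.
Proof. by case: mpure_balanced. Qed.
Lemma mpureA x a m : mpure (bract x a) m = mpure x (a *: m).
Proof. by case: mpure_balanced. Qed.

Lemma mtens_ind (Q : mtens -> Prop) :
  (forall x m, Q (mpure x m)) -> (forall t u, Q t -> Q u -> Q (t + u)) ->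
  forall t, Q t.
Proof.
move=> Q1 QD; apply: tens_ind => //.
suff <- : mpure 0 0 = 0 by [].
by rewrite (morphD0 (f := mpure^~ 0)) // => x y; rewrite mpureDl.
Qed.

Let mscale (a : L) : mtens -> mtens := mlift (fun x m => mpure (blact a x) m).

Let mscale_balanced a : mbalanced (fun x m => mpure (blact a x) m).
Proof.
have ax := bimod_actions X.
split=> [x y m|x m n|x b m]; first by rewrite (laDr ax) mpureDl.
  by rewrite mpureDr.
by rewrite (laraA ax) mpureA.
Qed.

Let mscaleD a : {morph mscale a : t u / t + u}.
Proof. exact: mliftD. Qed.
Let mscale_pure a x m : mscale a (mpure x m) = mpure (blact a x) m.
Proof. exact: mlift_pure. Qed.

Let mscaleA a b t : mscale a (mscale b t) = mscale (a * b) t.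
Proof.
elim/mtens_ind: t => [x m|t u IH IH']; last by rewrite !mscaleD IH IH'.
by rewrite !mscale_pure (laM (bimod_actions X)).
Qed.
Let mscale1 : left_id 1 mscale.
Proof.
elim/mtens_ind=> [x m|t u IH IH']; last by rewrite !mscaleD IH IH'.
by rewrite !mscale_pure (la1 (bimod_actions X)).
Qed.
Let mscaleDl t : {morph mscale^~ t : a b / a + b}.
Proof.
move=> a b; elim/mtens_ind: t => [x m|t u IH IH'].
  by rewrite !mscale_pure (laDl (bimod_actions X)) mpureDl.
by rewrite !mscaleD IH IH' addrACA.
Qed.

HB.instance Definition _ := GRing.Zmodule_isLmodule.Build L mtens
  mscaleA mscale1 mscaleD mscaleDl.

Lemma mpureZ a x m : a *: mpure x m = mpure (blact a x) m.
Proof. exact: mscale_pure. Qed.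
End ModuleTensor.

Section TensorMaps.
Variables (k : fieldType) (L : algType k).

Lemma linear_blact (X Y : lmodType (env L)) (f : {linear X -> Y}) a x :
  f (blact a x) = blact a (f x).
Proof. exact: linearZ. Qed.
Lemma linear_bract (X Y : lmodType (env L)) (f : {linear X -> Y}) x b :
  f (bract x b) = bract (f x) b.
Proof. exact: linearZ. Qed.

Section MMap.
Variables (X Y : lmodType (env L)) (M N : lmodType L).
Variables (f : {linear X -> Y}) (g : {linear M -> N}).

Definition mmap_fun : mtens X M -> mtens Y N :=
  mlift (fun x m => mpure (f x) (g m)).

Let mmap_balanced : mbalanced (fun x m => mpure (f x) (g m)).
Proof.
split=> [x y m|x m n|x b m]; rewrite ?linearD ?mpureDl ?mpureDr //.
by rewrite linear_bract mpureA linearZ.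
Qed.

Let mmap_pure x m : mmap_fun (mpure x m) = mpure (f x) (g m).
Proof. exact: mlift_pure. Qed.

Lemma mmap_linear : linear mmap_fun.
Proof.
have mD := mliftD mmap_balanced.
move=> a t u; rewrite /mmap_fun mD -/mmap_fun; congr (_ + _).
elim/mtens_ind: t => [x m|t v IH IH'].
  by rewrite mpureZ !mmap_pure mpureZ linear_blact.
by rewrite scalerDr /mmap_fun !mD -/mmap_fun IH IH' scalerDr.
Qed.

Definition mmap : {linear mtens X M -> mtens Y N} := mklin mmap_linear.

Lemma mmap_pureE x m : mmap (mpure x m) = mpure (f x) (g m).
Proof. exact: mmap_pure. Qed.
End MMap.

Section UnitIso.
Variable M : lmodType L.

Definition munit_fun : mtens (breg L) M -> M := 
  @mlift k L (breg L) M M (fun (a : L) (m : M) => a *: m).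

Let breg_bract (x : breg L) b : bract x b = (x * b : L).
Proof. by rewrite /bract breg_scale mul1r. Qed.
Let breg_blact a (x : breg L) : blact a x = (a * x : L).
Proof. by rewrite /blact breg_scale mulr1. Qed.

Let munit_balanced : @mbalanced k L (breg L) M M (fun (a : L) (m : M) => a *: m).
Proof.
split=> [x y m|x m n|x b m]; rewrite ?scalerDl ?scalerDr //.
by rewrite breg_bract scalerA.
Qed.

Lemma munit_linear : linear munit_fun.
Proof.
have mD := mliftD munit_balanced.
move=> a t u; rewrite /munit_fun mD -/munit_fun; congr (_ + _).
elim/mtens_ind: t => [x m|t v IH IH'].
  by rewrite mpureZ /munit_fun !mlift_pure // breg_blact scalerA.
by rewrite scalerDr /munit_fun !mD -/munit_fun IH IH' scalerDr.
Qed.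

Definition munit : {linear mtens (breg L) M -> M} := mklin munit_linear.

Lemma munitE (a : L) m : munit (mpure (a : breg L) m) = a *: m.
Proof. exact: mlift_pure. Qed.
End UnitIso.

Section Lres.
Variable Y : lmodType (env L).
(* The underlying left L-module of a bimodule. *)
Definition lres : Type := Y.
HB.instance Definition _ := GRing.Zmodule.on lres.
Let ax := bimod_actions Y.
Let lscaleA a b (y : lres) : (blact a (blact b y) : lres) = blact (a * b) y.
Proof. by rewrite (laM ax). Qed.
HB.instance Definition _ := GRing.Zmodule_isLmodule.Build L lres
  lscaleA (la1 ax) (laDr ax) (laDl ax).
End Lres.

Section LresMap.
Variables (X Y : lmodType (env L)) (f : {linear X -> Y}).
Let lres_linear : linear (f : lres X -> lres Y).
Proof. by move=> a x y; rewrite linearD; congr (_ + _); exact: linear_blact. Qed.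
Definition lres_map : {linear lres X -> lres Y} := mklin lres_linear.
End LresMap.

Section BTens.
Variables X Y : lmodType (env L).

Definition btens : Type := mtens X (lres Y).
HB.instance Definition _ := GRing.Zmodule.on btens.

Definition bpure (x : X) (y : Y) : btens := mpure x (y : lres Y).

Definition btens_ract (t : btens) (b : L) : btens :=
  mlift (fun (x : X) (y : lres Y) => mpure x (bract (y : Y) b : lres Y)) t.

Let bracB b : @mbalanced k L X (lres Y) btens
  (fun (x : X) (y : lres Y) => mpure x (bract (y : Y) b : lres Y)).
Proof.
split=> [x y m|x m n|x c m]; first exact: mpureDl.
  by rewrite (raDl (bimod_actions Y)); exact: mpureDr.
by rewrite mpureA -(laraA (bimod_actions Y)).
Qed.

Let bracD b : {morph btens_ract^~ b : t u / t + u}.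
Proof. exact: mliftD. Qed.
Let brac_pure b x y : btens_ract (bpure x y) b = bpure x (bract y b).
Proof. exact: mlift_pure. Qed.

Lemma btens_axioms :
  @bimod_axioms k L btens (fun a t => a *: (t : mtens X (lres Y))) btens_ract.
Proof.
have ax := bimod_actions Y.
split=> [a x y|x a b|a b x|x|b x y|x a b|x a b|x|a x b|c x] /=.
- exact: (@scalerDr L (mtens X (lres Y))).
- exact: (@scalerDl L (mtens X (lres Y))).
- exact/esym/(@scalerA L (mtens X (lres Y))).
- exact: (@scale1r L (mtens X (lres Y))).
- exact: bracD.
- elim/mtens_ind: x => [x y|t u IH IH'].
    by rewrite !brac_pure (raDr ax); exact: mpureDr.
  by rewrite !bracD IH IH' addrACA.
- elim/mtens_ind: x => [x y|t u IH IH'].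
    by rewrite !brac_pure (raM ax).
  by rewrite !bracD IH IH'.
- elim/mtens_ind: x => [x y|t u IH IH'].
    by rewrite !brac_pure (ra1 ax).
  by rewrite !bracD IH IH'.
- elim/mtens_ind: x => [x y|t u IH IH'].
    by rewrite !brac_pure [X in btens_ract X b]mpureZ mpureZ -/(bpure _ _) brac_pure.
  by rewrite !(bracD, scalerDr) IH IH'.
- elim/mtens_ind: x => [x y|t u IH IH'].
    rewrite brac_pure mpureZ (laraZ (bimod_actions X)) mpureA /bpure.
    by rewrite -(laraZ ax).
  by rewrite !(bracD, scalerDr) IH IH'.
Qed.

HB.instance Definition _ := GRing.Zmodule_isLmodule.Build (env L) btens
  (bscaleA btens_axioms) (bscale1 btens_axioms) (bscaleDr btens_axioms)
  (bscaleDl btens_axioms).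

Lemma bpureZ a b x y : epure a b *: bpure x y = bpure (blact a x) (bract y b).
Proof.
by rewrite [LHS](bscale_pure btens_axioms) brac_pure [LHS]mpureZ.
Qed.

Lemma btens_ind (Q : btens -> Prop) :
  (forall x m, Q (bpure x m)) -> (forall t u, Q t -> Q u -> Q (t + u)) ->
  forall t, Q t.
Proof. by move=> Q1 QD; apply: mtens_ind. Qed.
End BTens.

Section BMap.
Variables (X X' Y Y' : lmodType (env L)).
Variables (f : {linear X -> X'}) (g : {linear Y -> Y'}).

Definition bmap_fun (t : btens X Y) : btens X' Y' := mmap f (lres_map g) t.

Let bmap_pure x y : bmap_fun (bpure x y) = bpure (f x) (g y).
Proof. exact: mmap_pureE. Qed.

Let bmapD : {morph bmap_fun : t u / t + u}.
Proof. exact: (linearD (mmap f (lres_map g))). Qed.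

Lemma bmap_linear : linear bmap_fun.
Proof.
move=> a t u; rewrite bmapD; congr (_ + _).
elim/btens_ind: t => [x y|t v IH IH']; last first.
  by rewrite scalerDr !bmapD IH IH' scalerDr.
elim/env_ind: a => [a b|a c IH IH']; last by rewrite !scalerDl bmapD IH IH'.
by rewrite bpureZ !bmap_pure bpureZ linear_blact linear_bract.
Qed.

Definition bmap : {linear btens X Y -> btens X' Y'} := mklin bmap_linear.
Lemma bmap_pureE x y : bmap (bpure x y) = bpure (f x) (g y).
Proof. exact: bmap_pure. Qed.
End BMap.

(* The isomorphism L -> L (x)_L L, a |-> a (x) 1. *)
Section Diag.
Definition breg1 : breg L := (1 : L).

Definition bdiag_fun (a : breg L) : btens (breg L) (breg L) := bpure a breg1.

Lemma bdiag_linear : linear bdiag_fun.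
Proof.
have bD (x y : breg L) : bdiag_fun (x + y) = bdiag_fun x + bdiag_fun y.
  exact: mpureDl.
move=> t x y; rewrite bD; congr (_ + _).
elim/env_ind: t => [a b|t u IH IH']; last by rewrite !scalerDl bD IH IH'.
rewrite /bdiag_fun bpureZ breg_scale.
have -> : (a * (x * b) : L) = bract (blact a x) b.
  by rewrite /bract /blact !breg_scale mulr1 mul1r mulrA.
rewrite [LHS]mpureA; congr (mpure _ _).
change (blact b breg1 = bract breg1 b).
by rewrite /blact /bract !breg_scale !mul1r !mulr1.
Qed.

Definition bdiag : {linear breg L -> btens (breg L) (breg L)} := mklin bdiag_linear.
End Diag.

End TensorMaps.

Section Homological.
Variable A : pzRingType.

Definition surj (T U : Type) (f : T -> U) : Prop := forall y, exists x, f x = y.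

Definition short_exact (U V W : lmodType A) (f : {linear U -> V})
    (g : {linear V -> W}) : Prop :=
  [/\ injective f, (forall v, g v = 0 <-> exists u, f u = v) & surj g].

Definition split_short_exact (U V W : lmodType A) (f : {linear U -> V})
    (g : {linear V -> W}) : Prop :=
  short_exact f g /\ exists s : {linear W -> V}, cancel s g.

Definition projective (P : lmodType A) : Prop :=
  forall (U V : lmodType A) (p : {linear U -> V}) (f : {linear P -> V}),
    surj p -> exists h : {linear P -> U}, forall x, p (h x) = f x.

Definition essential (U V : lmodType A) (p : {linear U -> V}) : Prop :=
  surj p /\
  forall (W : lmodType A) (g : {linear W -> U}), surj (p \o g) -> surj g.

(* Syzygies: Omega^0 = X, Omega^(m+1) = K m. *)
Definition syz_of (X : lmodType A) (K : nat -> lmodType A) (n : nat) :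
    lmodType A :=
  if n is m.+1 then K m else X.

(* A projective resolution ... -> P^1 -> P^0 -> X -> 0 cut into the short
   exact sequences 0 -> Omega^(n+1) -> P^n -> Omega^n -> 0; the differential
   P^(n+1) -> P^n is rinc n \o repi n.+1. *)
Record resolution (X : lmodType A) : Type := Resolution {
  rproj : nat -> lmodType A;
  rker : nat -> lmodType A;
  rinc : forall n, {linear rker n -> rproj n};
  repi : forall n, {linear rproj n -> syz_of X rker n};
  rproj_projective : forall n, projective (rproj n);
  r_exact : forall n, short_exact (rinc n) (repi n) }.

Arguments rproj_projective {X} r n.
Arguments r_exact {X} r n.

(* Each P^n -> Omega^n is a projective cover. *)
Definition minimal (X : lmodType A) (R : resolution X) : Prop :=
  forall n, essential (repi R n).

(* g is induced on kernels by a map h of the middle terms covering f. *)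
Definition is_syz_lift (K P O K' P' O' : lmodType A)
    (i : {linear K -> P}) (p : {linear P -> O})
    (i' : {linear K' -> P'}) (p' : {linear P' -> O'})
    (f : {linear O -> O'}) (g : {linear K -> K'}) : Prop :=
  exists h : {linear P -> P'},
    (forall x, p' (h x) = f (p x)) /\ (forall x, i' (g x) = h (i x)).

Lemma syz_lift_ex (K P O K' P' O' : lmodType A)
    (i : {linear K -> P}) (p : {linear P -> O})
    (i' : {linear K' -> P'}) (p' : {linear P' -> O'}) (f : {linear O -> O'}) :
  projective P -> short_exact i p -> short_exact i' p' ->
  exists g : {linear K -> K'}, is_syz_lift i p i' p' f g.
Proof.
move=> Pproj [_ ip _] [i'_inj ip' p'_surj].
have [h hP] := Pproj _ _ p' (f \o p) p'_surj.
have ex x : exists y, i' y = h (i x).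
  by apply/ip'; rewrite hP /= (_ : p (i x) = 0) ?linear0 //; apply/ip; exists x.
have [g gP] := choice ex.
have gl : linear g.
  by move=> a x y; apply: i'_inj; rewrite linearP !gP !linearP.
by exists (mklin gl), h; split.
Qed.

Section Ext.
Variables (X : lmodType A) (R : resolution X).

Definition syz (n : nat) : lmodType A := syz_of X (rker R) n.

(* A cocycle P^n -> Y is the same as a map Omega^n -> Y, since
   Omega^n = coker (P^(n+1) -> P^n); it is a coboundary iff it extends along
   Omega^n -> P^(n-1).  Hence Ext^n(X, Y) is the group of linear maps
   Omega^n -> Y modulo those satisfying this predicate. *)
Definition coboundary (Y : lmodType A) (n : nat) : (syz n -> Y) -> Prop :=
  match n return (syz n -> Y) -> Prop with
  | 0 => fun f => forall x, f x = 0
  | m.+1 => fun f => exists g : {linear rproj R m -> Y},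
                       forall x, f x = g (rinc R m x)
  end.

Lemma cob_ext (Y : lmodType A) n (f g : syz n -> Y) :
  f =1 g -> coboundary f -> coboundary g.
Proof.
case: n f g => [|n] f g e /= h; first by move=> x; rewrite -e.
by case: h => u hu; exists u => x; rewrite -e.
Qed.

Lemma cob0 (Y : lmodType A) n : @coboundary Y n (fun=> 0).
Proof. by case: n => //= n; exists \0 => x. Qed.

Lemma cobD (Y : lmodType A) n (f g : syz n -> Y) :
  coboundary f -> coboundary g -> coboundary (fun x => f x + g x).
Proof.
case: n f g => [|n] f g /=; first by move=> hf hg x; rewrite hf hg addr0.
by move=> [u hu] [v hv]; exists (u \+ v) => x /=; rewrite hu hv.
Qed.

Lemma cob_post (Y Z : lmodType A) n (f : syz n -> Y) (h : {linear Y -> Z}) :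
  coboundary f -> coboundary (fun x => h (f x)).
Proof.
case: n f => [|n] f /=; first by move=> hf x; rewrite hf linear0.
by move=> [u hu]; exists (h \o u) => x /=; rewrite hu.
Qed.

Lemma cobN (Y : lmodType A) n (f : syz n -> Y) :
  coboundary f -> coboundary (fun x => - f x).
Proof.
case: n f => [|n] f /=; first by move=> hf x; rewrite hf oppr0.
by move=> [u hu]; exists (\- u) => x /=; rewrite hu.
Qed.

Lemma cobB (Y : lmodType A) n (f g : syz n -> Y) :
  coboundary f -> coboundary g -> coboundary (fun x => f x - g x).
Proof. by move=> hf hg; apply: cobD => //; exact: cobN. Qed.

Lemma cob_sum (Y : lmodType A) n (I : Type) (r : seq I) (P : pred I)
    (f : I -> syz n -> Y) :
  (forall i, P i -> coboundary (f i)) ->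
  coboundary (fun x => \sum_(i <- r | P i) f i x).
Proof.
move=> h; elim: r => [|i r IH].
  by apply: (cob_ext _ (@cob0 _ _)) => x; rewrite big_nil.
case: (boolP (P i)) => Pi.
  by apply: (cob_ext _ (cobD (h _ Pi) IH)) => x; rewrite big_cons Pi.
by apply: (cob_ext _ IH) => x; rewrite big_cons (negPf Pi).
Qed.

Definition is_next i j (f : {linear syz i -> syz j})
    (g : {linear syz i.+1 -> syz j.+1}) : Prop :=
  is_syz_lift (rinc R i) (repi R i) (rinc R j) (repi R j) f g.

Definition next i j (f : {linear syz i -> syz j}) :
    {linear syz i.+1 -> syz j.+1} :=
  projT1 (cid (syz_lift_ex f (rproj_projective R i) (r_exact R i) (r_exact R j))).

Lemma nextP i j (f : {linear syz i -> syz j}) : is_next f (next f).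
Proof. exact: (projT2 (cid _)). Qed.

Lemma is_next_cob i j (f : {linear syz i -> syz j})
    (g : {linear syz i.+1 -> syz j.+1}) :
  is_next f g -> coboundary f -> @coboundary _ i.+1 g.
Proof.
move=> [h [hf hg]] fb.
have [inc_inj ex_ p_surj] := r_exact R j.
have [v vP] : exists v : {linear rproj R i -> rproj R j},
    (forall x, repi R j (v x) = f (repi R i x)) /\ (forall x, v (rinc R i x) = 0).
  case: i f g h hf hg fb => [|i] f g h hf hg /= fb.
    by exists \0; split=> x //=; rewrite fb linear0.
  have [u hu] := fb.
  have [v hv] := rproj_projective R i _ _ _ u p_surj.
  exists (v \o rinc R i \o repi R i.+1); split=> x /=; first by rewrite hv hu.
  have [_ e _] := r_exact R i.+1.
  by rewrite (_ : repi R i.+1 (rinc R i.+1 x) = 0) ?linear0 //; apply/e; exists x.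
case: vP => v1 v2.
have ex x : exists y, rinc R j y = h x - v x.
  by apply/ex_; rewrite linearB hf v1 subrr.
have [w wP] := choice ex.
have wl : linear w.
  move=> a x y; apply: inc_inj; rewrite linearP !wP (linearP h) (linearP v) scalerBr.
  by rewrite opprD addrACA.
exists (mklin wl) => x; apply: inc_inj.
by rewrite hg [RHS]wP v2 subr0.
Qed.

Lemma is_nextB i j (f f' : {linear syz i -> syz j})
    (g g' : {linear syz i.+1 -> syz j.+1}) :
  is_next f g -> is_next f' g' -> is_next (f \- f') (g \- g').
Proof.
move=> [h [hf hg]] [h' [hf' hg']]; exists (h \- h'); split=> x /=.
  by rewrite linearB hf hf'.
by rewrite linearB hg hg'.
Qed.

Lemma is_nextD i j (f f' : {linear syz i -> syz j})
    (g g' : {linear syz i.+1 -> syz j.+1}) :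
  is_next f g -> is_next f' g' -> is_next (f \+ f') (g \+ g').
Proof.
move=> [h [hf hg]] [h' [hf' hg']]; exists (h \+ h'); split=> x /=.
  by rewrite linearD hf hf'.
by rewrite linearD hg hg'.
Qed.

Lemma is_next_comp i j l (f : {linear syz j -> syz l}) (f' : {linear syz i -> syz j})
    (g : {linear syz j.+1 -> syz l.+1}) (g' : {linear syz i.+1 -> syz j.+1}) :
  is_next f g -> is_next f' g' -> is_next (f \o f') (g \o g').
Proof.
move=> [h [hf hg]] [h' [hf' hg']]; exists (h \o h'); split=> x /=.
  by rewrite hf hf'.
by rewrite hg hg'.
Qed.

Lemma is_next0 i j :
  is_next (\0 : {linear syz i -> syz j}) (\0 : {linear syz i.+1 -> syz j.+1}).
Proof. by exists \0; split=> x /=; rewrite linear0. Qed.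

Lemma is_next_id i : is_next (idfun : {linear syz i -> syz i}) (idfun : {linear syz i.+1 -> syz i.+1}).
Proof. by exists idfun; split=> x. Qed.

Lemma next_unique i j (f f' : {linear syz i -> syz j})
    (g g' : {linear syz i.+1 -> syz j.+1}) :
  is_next f g -> is_next f' g' -> coboundary (fun x => f x - f' x) ->
  @coboundary _ i.+1 (fun x => g x - g' x).
Proof. by move=> h h' b; apply: (is_next_cob (is_nextB h h')). Qed.

Definition family := forall n, {linear syz n -> X}.

(* chain a i j : Omega^i -> Omega^j is the lift of a (i - j) : Omega^(i-j) -> X
   to the j-th syzygies (and 0 if i < j). *)
Fixpoint chain (a : family) (i j : nat) {struct j} : {linear syz i -> syz j} :=
  match j return {linear syz i -> syz j} with
  | 0 => a i
  | j'.+1 =>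
      match i return {linear syz i -> syz j'.+1} with
      | 0 => \0
      | i'.+1 => next (chain a i' j')
      end
  end.

Lemma cob_pre_next (Y : lmodType A) i j (c : syz j.+1 -> Y)
  (f : {linear syz i -> syz j}) :
  @coboundary Y j.+1 c -> @coboundary Y i.+1 (fun x => c (next f x)).
Proof.
move=> [u hu]; have [h [_ hg]] := nextP f.
by exists (u \o h) => x /=; rewrite hu hg.
Qed.

Lemma cob_chain (a : family) n j (Y : lmodType A) (c : syz j -> Y) :
  (j <= n)%N -> coboundary c -> coboundary (fun x => c (chain a n j x)).
Proof.
case: j c => [|j] c; first by move=> _ /= h; apply: (cob_ext _ (@cob0 _ _)) => x; rewrite h.
by case: n => // n _ h; exact: cob_pre_next.
Qed.

Lemma chain_congr (a a' : family) :
  (forall n, coboundary (fun x => a n x - a' n x)) ->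
  forall i j, coboundary (fun x => chain a i j x - chain a' i j x).
Proof.
move=> h i j; elim: j i => [|j IH] [|i].
- exact: (h 0%N).
- exact: (h i.+1).
- by move=> x; exact: subrr.
exact: (next_unique (nextP _) (nextP _) (IH i)).
Qed.

Lemma chain_cob (a : family) n j : (j <= n)%N -> coboundary (a (n - j)%N) ->
  coboundary (chain a n j).
Proof.
elim: j n => [|j IH] [|n] // jn h.
exact: (is_next_cob (nextP _) (IH n jn h)).
Qed.

Definition addf (a b : family) : family := fun n => a n \+ b n.
Definition oppf (a : family) : family := fun n => \- a n.
Definition zerof : family := fun n => \0.
Definition onef : family := fun n =>
  match n return {linear syz n -> X} with 0 => idfun | _.+1 => \0 end.

Lemma chainD (a b : family) i j :
  coboundary (fun x => chain (addf a b) i j x - (chain a i j x + chain b i j x)).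
Proof.
elim: j i => [|j IH] [|i].
- by move=> x; exact: subrr.
- by exists \0 => x; exact: subrr.
- by move=> x; rewrite /= addr0; exact: subrr.
exact: (next_unique (nextP _) (is_nextD (nextP _) (nextP _)) (IH i)).
Qed.

Lemma chain1_diag j : coboundary (fun x => chain onef j j x - x).
Proof.
elim: j => [|j IH]; first by move=> x; exact: subrr.
exact: (next_unique (nextP _) (is_next_id _) IH).
Qed.

Lemma chain1_off i j : i != j -> coboundary (chain onef i j).
Proof.
elim: j i => [|j IH] [|i] //=; first by exists \0.
by rewrite eqSS => ij; exact: (is_next_cob (nextP _) (IH i ij)).
Qed.

(* Yoneda product: in degree n, the sum over j of b_j composed with the j-th
   syzygy lift of a_(n-j). *)
Definition mulf_fun (b a : family) n (x : syz n) : X :=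
  \sum_(j < n.+1) b j (chain a n j x).

Lemma mulf_linear b a n : linear (mulf_fun b a (n := n)).
Proof.
move=> c x y; rewrite /mulf_fun scaler_sumr -big_split.
by apply: eq_bigr => j _; rewrite !linearP.
Qed.

Definition mulf (b a : family) : family := fun n => mklin (mulf_linear b a (n := n)).

Definition suml (U V : lmodType A) (I : finType) (P : pred I) (f : I -> {linear U -> V}) (x : U) : V :=
  \sum_(i | P i) f i x.
Lemma suml_linear U V I P f : linear (@suml U V I P f).
Proof.
move=> c x y; rewrite /suml scaler_sumr -big_split.
by apply: eq_bigr => j _; rewrite !linearP.
Qed.

Lemma is_next_sum i j (I : finType) (P : pred I) (f : I -> {linear syz i -> syz j})
    (g : I -> {linear syz i.+1 -> syz j.+1}) :
  (forall l, is_next (f l) (g l)) ->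
  is_next (mklin (suml_linear P f)) (mklin (suml_linear P g)).
Proof.
move=> h; have [u hu] := choice h.
exists (mklin (suml_linear P u)); split=> x /=; rewrite /suml linear_sum /=.
  by apply: eq_bigr => l _; have [-> _] := hu l.
by apply: eq_bigr => l _; have [_ ->] := hu l.
Qed.

Lemma chainM (b a : family) n j :
  coboundary (fun x => chain (mulf b a) n j x
     - \sum_(l < n.+1 | (j <= l)%N) chain b l j (chain a n l x)).
Proof.
elim: j n => [|j IH] n.
  apply: (cob_ext _ (@cob0 _ _)) => x; apply/esym/eqP; rewrite subr_eq0; apply/eqP.
  exact: eq_bigl.
case: n => [|n].
  by move=> x; rewrite big1 ?subrr // => -[[|l] hl].
pose f (l : 'I_n.+1) : {linear syz n -> syz j} := chain b l j \o chain a n l.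
pose g (l : 'I_n.+1) : {linear syz n.+1 -> syz j.+1} :=
  chain b l.+1 j.+1 \o chain a n.+1 l.+1.
have fg l : is_next (f l) (g l) by exact: is_next_comp (nextP _) (nextP _).
have := next_unique (nextP (chain (mulf b a) n j))
  (is_next_sum (fun l : 'I_n.+1 => (j <= l)%N) fg) (IH n).
apply: cob_ext => x; congr (_ - _).
rewrite [RHS]big_mkcond [RHS]big_ord_recl /= add0r /suml big_mkcond.
by apply: eq_bigr => l _.
Qed.

Definition eqf (a b : family) : Prop := forall n, coboundary (fun x => a n x - b n x).

Lemma eqf_pt (a b : family) : (forall n x, a n x = b n x) -> eqf a b.
Proof. by move=> h n; apply: (cob_ext _ (@cob0 _ _)) => x; rewrite h subrr. Qed.
Lemma eqf_refl a : eqf a a. Proof. exact: eqf_pt. Qed.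
Lemma eqf_sym a b : eqf a b -> eqf b a.
Proof. by move=> h n; apply: (cob_ext _ (cobN (h n))) => x; rewrite opprB. Qed.
Lemma eqf_trans a b c : eqf a b -> eqf b c -> eqf a c.
Proof.
by move=> h h' n; apply: (cob_ext _ (cobD (h n) (h' n))) => x; rewrite addrA subrK.
Qed.
Lemma eqfD a a' b b' : eqf a a' -> eqf b b' -> eqf (addf a b) (addf a' b').
Proof.
move=> h h' n; apply: (cob_ext _ (cobD (h n) (h' n))) => x /=.
by rewrite opprD addrACA.
Qed.
Lemma eqfN a a' : eqf a a' -> eqf (oppf a) (oppf a').
Proof.
by move=> h n; apply: (cob_ext _ (cobN (h n))) => x /=; rewrite opprD.
Qed.
Lemma eqfM b b' a a' : eqf b b' -> eqf a a' -> eqf (mulf b a) (mulf b' a').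
Proof.
move=> hb ha n.
have h1 : coboundary (fun x => \sum_(j < n.+1) (b j (chain a n j x) - b' j (chain a n j x))).
  apply: cob_sum => j _.
  exact: (@cob_chain a n j X (fun y => b j y - b' j y) (ltn_ord j) (hb j)).
have h2 : coboundary (fun x => \sum_(j < n.+1) b' j (chain a n j x - chain a' n j x)).
  apply: cob_sum => j _.
  exact: (cob_post (b' j) (chain_congr ha n j)).
apply: (cob_ext _ (cobD h1 h2)) => x.
rewrite -big_split /= /mulf_fun -sumrB; apply: eq_bigr => j _.
by rewrite linearB addrA subrK.
Qed.

Lemma mulfA c b a : eqf (mulf c (mulf b a)) (mulf (mulf c b) a).
Proof.
move=> n.
have h : coboundary (fun x => \sum_(j < n.+1) c j (chain (mulf b a) n j x
     - \sum_(l < n.+1 | (j <= l)%N) chain b l j (chain a n l x))).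
  by apply: cob_sum => j _; exact: (cob_post (c j) (chainM b a n j)).
apply: (cob_ext _ h) => x; rewrite /= /mulf_fun.
under eq_bigr do rewrite linearB; rewrite sumrB; congr (_ - _).
under eq_bigr do rewrite linear_sum.
rewrite (exchange_big_dep xpredT) //=; apply: eq_bigr => l _.
transitivity (\sum_(j < l.+1) c j (chain b l j (chain a n l x))); last by [].
rewrite (big_ord_widen n.+1 (fun j => c j (chain b l j (chain a n l x)))) //.
Qed.

Lemma mul1f a : eqf (mulf onef a) a.
Proof.
apply: eqf_pt => n x; rewrite /= /mulf_fun big_ord_recl big1 ?addr0 //.
Qed.

Lemma mulf1 a : eqf (mulf a onef) a.
Proof.
move=> n.
have h : coboundary (fun x => \sum_(j < n) a j (chain onef n j x)
    + a n (chain onef n n x - x)).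
  apply: cobD; last exact: (cob_post (a n) (chain1_diag n)).
  apply: cob_sum => j _; apply: (cob_post (a j)); apply: chain1_off.
  by rewrite gtn_eqF.
apply: (cob_ext _ h) => x /=.
by rewrite /mulf_fun big_ord_recr /= linearB addrA.
Qed.

Lemma mulfDl a b c : eqf (mulf (addf a b) c) (addf (mulf a c) (mulf b c)).
Proof. by apply: eqf_pt => n x /=; rewrite /mulf_fun -big_split. Qed.

Lemma mulfDr a b c : eqf (mulf a (addf b c)) (addf (mulf a b) (mulf a c)).
Proof.
move=> n.
have h : coboundary (fun x => \sum_(j < n.+1) a j (chain (addf b c) n j x -
    (chain b n j x + chain c n j x))).
  by apply: cob_sum => j _; exact: (cob_post (a j) (chainD b c n j)).
apply: (cob_ext _ h) => x /=; rewrite /mulf_fun -big_split -sumrB.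
by apply: eq_bigr => j _; rewrite linearB linearD.
Qed.

(* The class vanishes in all large degrees, i.e. the family defines an element
   of the direct sum of the groups Ext^n(X, X). *)
Definition fin_supp (a : family) : Prop :=
  exists N, forall n, (N <= n)%N -> coboundary (a n).

Record cochain := Cochain { cval : family; cval_supp : fin_supp cval }.
HB.instance Definition _ := gen_eqMixin cochain.
HB.instance Definition _ := gen_choiceMixin cochain.

Lemma fin_supp0 : fin_supp zerof.
Proof. by exists 0%N => n _; exact: cob0. Qed.
Lemma fin_supp1 : fin_supp onef.
Proof. by exists 1%N => -[//|n] _; exact: (@cob0 _ n.+1). Qed.
Lemma fin_suppD (a b : cochain) : fin_supp (addf (cval a) (cval b)).
Proof.
case: (cval_supp a) (cval_supp b) => [N hN] [N' hN'].
exists (maxn N N') => n; rewrite geq_max => /andP[/hN h /hN' h'].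
exact: (cobD h h').
Qed.
Lemma fin_suppN (a : cochain) : fin_supp (oppf (cval a)).
Proof. by case: (cval_supp a) => [N hN]; exists N => n /hN; exact: cobN. Qed.
Lemma fin_suppM (b a : cochain) : fin_supp (mulf (cval b) (cval a)).
Proof.
case: (cval_supp b) (cval_supp a) => [N hN] [N' hN'].
exists (N + N')%N => n hn; apply: cob_sum => j _.
have jn : (j <= n)%N by rewrite -ltnS; exact: ltn_ord.
case: (leqP N j) => Nj; first by apply: cob_chain => //; exact: hN.
apply: (cob_post (cval b j)); apply: chain_cob => //; apply: hN'.
by rewrite leq_subRL // (leq_trans _ hn) // leq_add2r ltnW.
Qed.

Definition ext_eq (a b : cochain) : bool := `[< eqf (cval a) (cval b) >].
Lemma ext_eq_refl : reflexive ext_eq.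
Proof. by move=> a; apply/asboolP; exact: eqf_refl. Qed.
Lemma ext_eq_sym : symmetric ext_eq.
Proof. by move=> a b; apply/asboolP/asboolP; exact: eqf_sym. Qed.
Lemma ext_eq_trans : transitive ext_eq.
Proof. by move=> b a c /asboolP h /asboolP h'; apply/asboolP; exact: eqf_trans h h'. Qed.
Canonical ext_equiv := EquivRel ext_eq ext_eq_refl ext_eq_sym ext_eq_trans.

(* Ext^*(X, X), the direct sum of the Ext^n(X, X), computed with R; a ring
   under the Yoneda product. *)
Definition ext : Type := {eq_quot ext_eq}.
HB.instance Definition _ := Choice.on ext.

Definition ext_class (a : cochain) : ext := \pi_({eq_quot ext_eq}) a.
Definition ext_repr (q : ext) : cochain := repr (q : {eq_quot ext_eq}).

Lemma ext_reprK q : ext_class (ext_repr q) = q. Proof. exact: reprK. Qed.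
Lemma ext_classP a b : ext_class a = ext_class b <-> eqf (cval a) (cval b).
Proof. by split=> [/eqmodP/asboolP|e] //; apply/eqmodP/asboolP. Qed.
Lemma ext_reprP a : eqf (cval (ext_repr (ext_class a))) (cval a).
Proof. by apply/ext_classP; rewrite ext_reprK. Qed.

Definition ext_zero : ext := ext_class (Cochain fin_supp0).
Definition ext_one : ext := ext_class (Cochain fin_supp1).
Definition ext_add (p q : ext) : ext :=
  ext_class (Cochain (fin_suppD (ext_repr p) (ext_repr q))).
Definition ext_opp (p : ext) : ext :=
  ext_class (Cochain (fin_suppN (ext_repr p))).
Definition ext_mul (p q : ext) : ext :=
  ext_class (Cochain (fin_suppM (ext_repr p) (ext_repr q))).

Lemma ext_addE a b :
  ext_add (ext_class a) (ext_class b) = ext_class (Cochain (fin_suppD a b)).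
Proof. by apply/ext_classP; apply: eqfD; exact: ext_reprP. Qed.
Lemma ext_mulE a b :
  ext_mul (ext_class a) (ext_class b) = ext_class (Cochain (fin_suppM a b)).
Proof. by apply/ext_classP; apply: eqfM; exact: ext_reprP. Qed.
Lemma ext_oppE a : ext_opp (ext_class a) = ext_class (Cochain (fin_suppN a)).
Proof. by apply/ext_classP; apply: eqfN; exact: ext_reprP. Qed.

Let extaddA : associative ext_add.
Proof.
move=> p q r; rewrite -(ext_reprK p) -(ext_reprK q) -(ext_reprK r) !ext_addE.
by apply/ext_classP; apply: eqf_pt => n x /=; rewrite addrA.
Qed.
Let extaddC : commutative ext_add.
Proof.
move=> p q; rewrite -(ext_reprK p) -(ext_reprK q) !ext_addE.
by apply/ext_classP; apply: eqf_pt => n x /=; rewrite addrC.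
Qed.
Let extadd0 : left_id ext_zero ext_add.
Proof.
move=> p; rewrite -(ext_reprK p) ext_addE.
by apply/ext_classP; apply: eqf_pt => n x /=; rewrite add0r.
Qed.
Let extaddN : left_inverse ext_zero ext_opp ext_add.
Proof.
move=> p; rewrite -(ext_reprK p) ext_oppE ext_addE.
by apply/ext_classP; apply: eqf_pt => n x /=; rewrite addNr.
Qed.
HB.instance Definition _ := GRing.isZmodule.Build ext extaddA extaddC extadd0 extaddN.

Let extmulA : associative ext_mul.
Proof.
move=> p q r; rewrite -(ext_reprK p) -(ext_reprK q) -(ext_reprK r) !ext_mulE.
by apply/ext_classP; exact: mulfA.
Qed.
Let extmul1 : left_id ext_one ext_mul.
Proof.
by move=> p; rewrite -(ext_reprK p) ext_mulE; apply/ext_classP; exact: mul1f.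
Qed.
Let extmulr1 : right_id ext_one ext_mul.
Proof.
by move=> p; rewrite -(ext_reprK p) ext_mulE; apply/ext_classP; exact: mulf1.
Qed.
Let extmulDl : left_distributive ext_mul +%R.
Proof.
move=> p q r; rewrite -(ext_reprK p) -(ext_reprK q) -(ext_reprK r).
rewrite -[ext_class _ + ext_class _]/(ext_add _ _) -[RHS]/(ext_add _ _).
by rewrite !(ext_mulE, ext_addE); apply/ext_classP; exact: mulfDl.
Qed.
Let extmulDr : right_distributive ext_mul +%R.
Proof.
move=> p q r; rewrite -(ext_reprK p) -(ext_reprK q) -(ext_reprK r).
rewrite -[ext_class _ + ext_class _]/(ext_add _ _) -[RHS]/(ext_add _ _).
by rewrite !(ext_mulE, ext_addE); apply/ext_classP; exact: mulfDr.
Qed.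
HB.instance Definition _ :=
  GRing.Zmodule_isPzRing.Build ext extmulA extmul1 extmulr1 extmulDl extmulDr.

End Ext.
End Homological.

Arguments rproj_projective {A X} r n.
Arguments r_exact {A X} r n.

(* From here to mtens_exact and resolution_rsplit: a projective bimodule
   resolution of L splits over L on the right, so it stays exact after
   tensoring with M; the definition of comparison relies on this. *)
Lemma linear_section (k : fieldType) (U V : lmodType k) (p : {linear U -> V}) :
  surj p -> exists s : {linear V -> U}, cancel s p.
Proof.
move=> p_surj.
pose Q (W : set U) := (forall c x y, W x -> W y -> W (c *: x + y)) /\
  (forall x, W x -> p x = 0 -> x = 0).
have [|W [[Wlin Wker] Wmax]] := @Zorn_bigcup U Q.
  move=> F FQ Ftot; split=> [c x y [X FX Xx] [Y FY Yy]|x [X FX Xx]]; last first.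
    by have [_ h] := FQ _ FX; exact: h.
  have [XY|YX] := Ftot _ _ FX FY.
    by exists Y => //; have [h _] := FQ _ FY; apply: h => //; exact: XY.
  by exists X => //; have [h _] := FQ _ FX; apply: h => //; exact: YX.
have bigger (B : set U) : Q B -> (W `<=` B)%classic -> (B `<=` W)%classic.
  move=> QB WB x Bx; apply: contrapT => nWx; apply: (Wmax B) => //.
  by split=> // BW; exact: nWx (BW _ Bx).
have W0 : W 0.
  apply: (bigger (fun x => W x \/ x = 0)); [|by move=> x; left|by right].
  split=> [c x y [Wx|->] [Wy|->]|x [/Wker|//] //].
  - by left; exact: Wlin.
  - by left; have := Wlin (c - 1) x x Wx Wx; rewrite scalerBl scale1r subrK addr0.
  - by left; rewrite scaler0 add0r.
  - by right; rewrite scaler0 add0r.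
have WZ c x : W x -> W (c *: x) by move=> Wx; rewrite -[c *: x]addr0; exact: Wlin.
have Wex v : exists w, W w /\ p w = v.
  have [u pu] := p_surj v; apply: contrapT => nex.
  pose B : set U := fun x => exists c w, W w /\ x = c *: u + w.
  apply: (nex); exists u; split=> //; apply: (bigger B).
  - split=> [c x y [d [w [Ww ->]]] [d' [w' [Ww' ->]]]|x [c [w [Ww ->]]]].
      exists (c * d + d'), (c *: w + w'); split; first exact: Wlin.
      by rewrite scalerDr scalerA scalerDl addrACA.
    rewrite linearP pu; case: (eqVneq c 0) => [->|c0].
      by rewrite !scale0r !add0r => /Wker ->.
    move=> e; exfalso; apply: nex; exists (- c^-1 *: w); split; first exact: WZ.
    rewrite linearZ_LR scaleNr.
    have -> : p w = - (c *: v) by apply/eqP; rewrite -addr_eq0 addrC e.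
    by rewrite scalerN opprK scalerA mulVf // scale1r.
  - by move=> x Wx; exists 0, x; split=> //; rewrite scale0r add0r.
  - by exists 1, 0; split=> //; rewrite scale1r addr0.
have [s sP] := choice Wex.
have sl : linear s.
  move=> c x y; apply/eqP; rewrite -subr_eq0; apply/eqP; apply: Wker.
    have [Wx _] := sP x; have [Wy _] := sP y; have [Wxy _] := sP (c *: x + y).
    by have := Wlin (-1) _ _ (Wlin c _ _ Wx Wy) Wxy; rewrite scaleN1r [X in _ -> W X]addrC.
  rewrite linearB linearP; have [_ ->] := sP x; have [_ ->] := sP y.
  by have [_ ->] := sP (c *: x + y); rewrite subrr.
by exists (mklin sl) => v; have [_] := sP v.
Qed.

Section RightLinear.
Variables (k : fieldType) (L : algType k).

Definition rlinear (X Y : lmodType (env L)) (f : X -> Y) : Prop :=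
  {morph f : x y / x + y} /\ forall x b, f (bract x b) = bract (f x) b.

Lemma rlinear0 X Y f : @rlinear X Y f -> f 0 = 0.
Proof. by case=> /morphD0. Qed.
Lemma rlinearN X Y f x : @rlinear X Y f -> f (- x) = - f x.
Proof.
by move=> h; apply/eqP; rewrite -addr_eq0 -(proj1 h) addNr (rlinear0 h).
Qed.

Section KRes.
Variable X : lmodType (env L).
(* The underlying k-module of a bimodule. *)
Definition kres : Type := X.
HB.instance Definition _ := GRing.Zmodule.on kres.
Let sc (c : k) (x : kres) : kres := blact (c *: 1) (x : X).
Let ax := bimod_actions X.
Let scA a b x : sc a (sc b x) = sc (a * b) x.
Proof. by rewrite /sc -(laM ax) -scalerAl mul1r scalerA. Qed.
Let sc1 : left_id 1 sc.
Proof. by move=> x; rewrite /sc scale1r (la1 ax). Qed.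
Let scDr : right_distributive sc +%R.
Proof. by move=> c x y; rewrite /sc (laDr ax). Qed.
Let scDl x : {morph sc^~ x : a b / a + b}.
Proof. by move=> a b; rewrite /sc scalerDl (laDl ax). Qed.
HB.instance Definition _ := GRing.Zmodule_isLmodule.Build k kres scA sc1 scDr scDl.
Lemma kresE c (x : kres) : c *: x = blact (c *: 1) (x : X). Proof. by []. Qed.
Lemma kresE' c (x : kres) : c *: x = bract (x : X) (c *: 1).
Proof. by rewrite kresE (laraZ ax). Qed.
End KRes.

Lemma ksection (X Y : lmodType (env L)) (p : {linear X -> Y}) : surj p ->
  exists s : Y -> X, [/\ {morph s : x y / x + y},
    (forall c y, s (bract y (c *: 1)) = bract (s y) (c *: 1)) & cancel s p].
Proof.
move=> ps.
have pl : linear (p : kres X -> kres Y).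
  by move=> c x y; rewrite !kresE linearD linear_blact.
have [s sp] := linear_section (p := mklin pl) ps.
exists s; split=> //; first by move=> x y; exact: linearD.
by move=> c y; rewrite -!kresE'; exact: (linearZ_LR s).
Qed.

(* The bimodule P (x)_k L. *)
Section Free.
Variable P : lmodType (env L).
Let ax := bimod_actions P.

Definition pfree : Type :=
  tens (fun (x : P) (c : k) => bract x (c *: 1)) (fun (c : k) (b : L) => c *: b).
HB.instance Definition _ := GRing.Zmodule.on pfree.
Definition pfpure (x : P) (b : L) : pfree := tpure _ _ x b.
Definition pfbalanced (G : zmodType) (f : P -> L -> G) : Prop :=
  @balanced k P L (fun (x : P) (c : k) => bract x (c *: 1))
    (fun (c : k) (b : L) => c *: b) G f.
Definition pflift (G : zmodType) (f : P -> L -> G) (t : pfree) : G :=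
  @tlift k P L _ _ G f t.

Lemma pfliftD (G : zmodType) (f : P -> L -> G) : pfbalanced f ->
  {morph pflift f : t u / t + u}.
Proof. by move=> bf t u; exact: tlift_is_additive. Qed.
Lemma pflift_pure (G : zmodType) (f : P -> L -> G) x b : pfbalanced f ->
  pflift f (pfpure x b) = f x b.
Proof. exact: tlift_pure. Qed.
Lemma pfpure_balanced : pfbalanced pfpure. Proof. exact: tpure_balanced. Qed.
Lemma pfDl x y b : pfpure (x + y) b = pfpure x b + pfpure y b.
Proof. by case: pfpure_balanced. Qed.
Lemma pfDr x a b : pfpure x (a + b) = pfpure x a + pfpure x b.
Proof. by case: pfpure_balanced. Qed.
Lemma pfA x c b : pfpure (bract x (c *: 1)) b = pfpure x (c *: b).
Proof. by case: pfpure_balanced. Qed.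
Lemma pf_ind (Q : pfree -> Prop) :
  (forall x m, Q (pfpure x m)) -> (forall t u, Q t -> Q u -> Q (t + u)) ->
  forall t, Q t.
Proof.
move=> Q1 QD; apply: tens_ind => //.
suff <- : pfpure 0 0 = 0 by [].
by rewrite (morphD0 (f := pfpure^~ 0)) // => x y; rewrite pfDl.
Qed.

Let pla (a : L) (t : pfree) : pfree := pflift (fun x b => pfpure (blact a x) b) t.
Let pra (t : pfree) (c : L) : pfree := pflift (fun x b => pfpure x (b * c)) t.

Let plaB a : pfbalanced (fun x b => pfpure (blact a x) b).
Proof.
split=> [x y m|x m n|x c m]; rewrite ?(laDr ax) ?pfDl ?pfDr //.
by rewrite (laraA ax) pfA.
Qed.
Let praB c : pfbalanced (fun x b => pfpure x (b * c)).
Proof.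
split=> [x y m|x m n|x d m]; rewrite ?mulrDl ?pfDl ?pfDr //.
by rewrite pfA scalerAl.
Qed.
Let plaD a : {morph pla a : t u / t + u}. Proof. exact: pfliftD. Qed.
Let praD a : {morph pra^~ a : t u / t + u}. Proof. exact: pfliftD. Qed.
Let plaE a x b : pla a (pfpure x b) = pfpure (blact a x) b.
Proof. exact: pflift_pure. Qed.
Let praE c x b : pra (pfpure x b) c = pfpure x (b * c).
Proof. exact: pflift_pure. Qed.

Lemma pfree_axioms : bimod_axioms pla pra.
Proof.
split=> [a x y|x a b|a b x|x|b x y|x a b|x a b|x|a x b|c x] /=.
- exact: plaD.
- elim/pf_ind: x => [x m|t u IH IH']; first by rewrite !plaE (laDl ax) pfDl.
  by rewrite !plaD IH IH' addrACA.
- elim/pf_ind: x => [x m|t u IH IH']; first by rewrite !plaE (laM ax).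
  by rewrite !plaD IH IH'.
- elim/pf_ind: x => [x m|t u IH IH']; first by rewrite !plaE (la1 ax).
  by rewrite !plaD IH IH'.
- exact: praD.
- elim/pf_ind: x => [x m|t u IH IH']; first by rewrite !praE mulrDr pfDr.
  by rewrite !praD IH IH' addrACA.
- elim/pf_ind: x => [x m|t u IH IH']; first by rewrite !praE mulrA.
  by rewrite !praD IH IH'.
- elim/pf_ind: x => [x m|t u IH IH']; first by rewrite !praE mulr1.
  by rewrite !praD IH IH'.
- elim/pf_ind: x => [x m|t u IH IH']; first by rewrite !(praE, plaE).
  by rewrite !(praD, plaD) IH IH'.
- elim/pf_ind: x => [x m|t u IH IH'].
    by rewrite plaE praE (laraZ ax) pfA -scalerAr mulr1.
  by rewrite !(praD, plaD) IH IH'.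
Qed.

HB.instance Definition _ := GRing.Zmodule_isLmodule.Build (env L) pfree
  (bscaleA pfree_axioms) (bscale1 pfree_axioms) (bscaleDr pfree_axioms)
  (bscaleDl pfree_axioms).

Lemma pfree_bract (t : pfree) b : bract t b = pra t b.
Proof. by rewrite /bract [LHS](bscale_pure pfree_axioms) (la1 pfree_axioms). Qed.

Definition pfmul : pfree -> P := pflift (fun x b => bract x b).
Let pfmulB : pfbalanced (fun x b => bract x b).
Proof.
split=> [x y m|x m n|x c m]; rewrite ?(raDl ax) ?(raDr ax) //.
by rewrite -(raM ax) -scalerAl mul1r.
Qed.
Let pfmulD : {morph pfmul : t u / t + u}. Proof. exact: pfliftD. Qed.
Lemma pfmulE x b : pfmul (pfpure x b) = bract x b. Proof. exact: pflift_pure. Qed.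
Lemma pfmul_linear : linear pfmul.
Proof.
move=> t x y; rewrite pfmulD; congr (_ + _).
elim/env_ind: t => [a b|t u IH IH']; last by rewrite !scalerDl pfmulD IH IH'.
rewrite [X in pfmul X](bscale_pure pfree_axioms).
elim/pf_ind: x => [x m|u v IH IH'].
  by rewrite praE plaE !pfmulE epureE -(raM ax) (laraA ax).
by rewrite praD plaD !pfmulD IH IH' scalerDr.
Qed.

Lemma proj_right_lift (X Y : lmodType (env L)) (p : {linear X -> Y}) (r : P -> Y) :
  projective P -> surj p -> rlinear r ->
  exists r' : P -> X, rlinear r' /\ forall x, p (r' x) = r x.
Proof.
move=> Pproj p_surj [rD rb].
have [s [sD sZ sp]] := ksection p_surj.
have mu_surj : surj (mklin pfmul_linear).
  by move=> x; exists (pfpure x 1); rewrite [LHS]pfmulE (ra1 ax).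
have [sg sgP] := Pproj _ _ (mklin pfmul_linear) idfun mu_surj.
have axX := bimod_actions X.
pose h (x : P) (b : L) : X := bract (s (r x)) b.
have hB : pfbalanced h.
  split=> [x y m|x m n|x c m]; rewrite /h ?rD ?sD ?(raDl axX) ?(raDr axX) //.
  by rewrite rb sZ -(raM axX) -scalerAl mul1r.
have hD := pfliftD hB.
exists (fun x => pflift h (sg x)); split; first split=> [x y|x b].
- by rewrite linearD hD.
- rewrite linear_bract pfree_bract; elim/pf_ind: (sg x) => [y m|t u IH IH'].
    by rewrite praE !pflift_pure // /h (raM axX).
  by rewrite praD !hD IH IH' (raDl axX).
- move=> x; transitivity (r (pfmul (sg x))); last by congr r; exact: sgP.
  elim/pf_ind: (sg x) => [y m|t u IH IH'].
    by rewrite pflift_pure // /h pfmulE rb linear_bract sp.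
  by rewrite hD pfmulD rD linearD IH IH'.
Qed.
End Free.

Section TensorExact.
Variable M : lmodType L.

Definition rmap (X Y : lmodType (env L)) (f : X -> Y) : mtens X M -> mtens Y M :=
  mlift (fun x m => mpure (f x) m).

Lemma rmap_balanced X Y f : @rlinear X Y f -> mbalanced (fun x (m : M) => mpure (f x) m).
Proof.
move=> [fD fb]; split=> [x y m|x m n|x b m]; rewrite ?fD ?mpureDl ?mpureDr //.
by rewrite fb mpureA.
Qed.
Lemma rmapD X Y f : @rlinear X Y f -> {morph @rmap X Y f : t u / t + u}.
Proof. by move=> h; exact: mliftD (rmap_balanced h). Qed.
Lemma rmap_pure X Y f x m : @rlinear X Y f -> rmap f (mpure x m) = mpure (f x) m.
Proof. by move=> h; rewrite /rmap mlift_pure //; exact: rmap_balanced. Qed.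

Definition rsplit (X Y : lmodType (env L)) (p : {linear X -> Y}) : Prop :=
  exists s : Y -> X, rlinear s /\ cancel s p.

Lemma rsplit_retract (K X Y : lmodType (env L)) (i : {linear K -> X})
    (p : {linear X -> Y}) (s : Y -> X) : short_exact i p -> rlinear s -> cancel s p ->
  exists r : X -> K, rlinear r /\ forall x, x = i (r x) + s (p x).
Proof.
move=> [i_inj ex_ _] [sD sb] sp.
have h x : exists y, i y = x - s (p x).
  by apply/ex_; rewrite linearB sp subrr.
have [r rP] := choice h.
exists r; split; last by move=> x; rewrite rP subrK.
split=> [x y|x b]; apply: i_inj.
  by rewrite linearD !rP linearD sD opprD addrACA.
rewrite linear_bract !rP linear_bract sb /bract scalerBr //.
Qed.

Lemma mtens_exact (K X Y : lmodType (env L)) (i : {linear K -> X})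
    (p : {linear X -> Y}) : short_exact i p -> rsplit p ->
  short_exact (mmap i (idfun : {linear M -> M})) (mmap p (idfun : {linear M -> M})).
Proof.
move=> ip [s [sl sp]]; have [r [rl rP]] := rsplit_retract ip sl sp.
have [i_inj ex_ _] := ip.
have ri x : r (i x) = x.
  apply: i_inj; have e := rP (i x).
  have pi0 : p (i x) = 0 by apply/ex_; exists x.
  by rewrite {2}e pi0 (rlinear0 sl) addr0.
have rK t : rmap r (mmap i idfun t) = t.
  elim/mtens_ind: t => [x m|t u IH IH']; first by rewrite mmap_pureE rmap_pure // ri.
  by rewrite linearD rmapD // IH IH'.
have sK t : mmap p idfun (rmap s t) = t.
  elim/mtens_ind: t => [x m|t u IH IH']; first by rewrite rmap_pure // mmap_pureE sp.
  by rewrite rmapD // linearD IH IH'.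
have dec t : t = mmap i idfun (rmap r t) + rmap s (mmap p idfun t).
  elim/mtens_ind: t => [x m|t u IH IH'].
    by rewrite !mmap_pureE !rmap_pure // mmap_pureE -mpureDl -rP.
  rewrite {1}IH {1}IH' (linearD (mmap p idfun)) !rmapD //.
  by rewrite (linearD (mmap i idfun)) addrACA.
split.
- by move=> t u e; rewrite -[t]rK -[u]rK e.
- move=> t; split=> [e|[u <-]].
    by exists (rmap r t); rewrite {2}(dec t) e (morphD0 (rmapD sl)) addr0.
  elim/mtens_ind: u => [x m|u v IH IH'].
    rewrite !mmap_pureE (_ : p (i x) = 0); last by apply/ex_; exists x.
    by rewrite (morphD0 (f := fun y => mpure y _)) // => y z; rewrite mpureDl.
  by rewrite (linearD (mmap i idfun)) (linearD (mmap p idfun)) IH IH' addr0.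
- by move=> t; exists (rmap s t).
Qed.

Lemma resolution_rsplit (R : resolution (breg L)) n : rsplit (repi R n).
Proof.
elim: n => [|n [s [sl sp]]].
  have [_ _ ps] := r_exact R 0; have [u pu] := ps (breg1 L).
  exists (fun a : breg L => bract u (a : L)); split; first split=> [x y|x b].
  - by rewrite (raDr (bimod_actions _)).
  - by rewrite -(raM (bimod_actions _)) /bract breg_scale mul1r.
  - by move=> a; rewrite linear_bract pu /bract breg_scale !mul1r.
have [r [rl rP]] := rsplit_retract (r_exact R n) sl sp.
have [_ _ ps] := r_exact R n.+1.
have [r' [[r'D r'b] r'P]] := proj_right_lift (rproj_projective R n) ps rl.
exists (fun x => r' (rinc R n x)); split; first split=> [x y|x b].
- by rewrite linearD r'D.
- by rewrite linear_bract r'b.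
move=> x; rewrite r'P.
have [i_inj ex_ _] := r_exact R n; apply: i_inj.
have pi0 : repi R n (rinc R n x) = 0 by apply/ex_; exists x.
by rewrite {2}(rP (rinc R n x)) pi0 (rlinear0 sl) addr0.
Qed.
End TensorExact.
End RightLinear.

Definition fin_gen (A : pzRingType) (M : lmodType A) : Prop :=
  exists s : seq M, forall m, exists c : nat -> A,
    m = \sum_(i < size s) c i *: s`_i.

Definition direct_summand (A : pzRingType) (M N : lmodType A) : Prop :=
  exists (C : lmodType A) (f : {linear (M * C)%type -> N}), bijective f.

(* algType structures are nonzero rings, so B and C are nonzero algebras. *)
Definition indecomposable (k : fieldType) (L : algType k) : Prop :=
  ~ exists (B C : algType k) (f : {lrmorphism L -> (B * C)%type}), bijective f.

Definition two_sided_ideal (B : pzRingType) (I : set B) : Prop :=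
  [/\ I 0, forall x y, I x -> I y -> I (x + y)
    & forall b x, I x -> I (b * x) /\ I (x * b)].

Definition ideal_gen (B : pzRingType) (S : set B) : set B :=
  fun x => forall I : set B, two_sided_ideal I -> (S `<=` I)%classic -> I x.

(* The pushout (Y + P) / {(f x, - i x)} of i along f, with the maps
   Y -> pushout and pushout -> W induced by p : P -> W when p \o i = 0. *)
Section Pushout.
Variables (A : pzRingType) (K Y P W : lmodType A).
Variables (f : {linear K -> Y}) (i : {linear K -> P}) (p : {linear P -> W}).

Let span_linear : linear (fun x : K => (f x, - i x) : (Y * P)%type).
Proof.
move=> a x y; congr (_, _); first exact: linearP.
by rewrite /= (linearP i) opprD scalerN.
Qed.

Definition pushout : lmodType A := cok (mklin span_linear).

Let inl_linear : linear (fun y : Y => (y, 0) : (Y * P)%type).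
Proof. by move=> a x y; congr (_, _); rewrite /= ?scaler0 ?addr0. Qed.

Definition pushout_inl : {linear Y -> pushout} :=
  cok_proj (mklin span_linear) \o mklin inl_linear.

Let desc_linear : linear (fun yp : (Y * P)%type => p yp.2).
Proof. by move=> a x y; rewrite linearP. Qed.

Hypothesis pi0 : forall x, p (i x) = 0.

Let desc0 x : mklin desc_linear (mklin span_linear x) = 0.
Proof. by change (p (- i x) = 0); rewrite linearN pi0 oppr0. Qed.

Definition pushout_desc : {linear pushout -> W} := cok_lift desc0.
End Pushout.

Section Action.
Variables (k : fieldType) (L : algType k) (M : lmodType L).
Variables (R : resolution (breg L)) (Q : resolution M).

Let inv_fun (m : M) : mtens (breg L) M := mpure (breg1 L) m.
Let inv_linear : linear inv_fun.
Proof.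
move=> a x y; rewrite /inv_fun mpureDr mpureZ; congr (_ + _).
rewrite -mpureA; congr mpure.
by rewrite /bract /blact !breg_scale !mul1r mulr1.
Qed.
Definition munit_inv : {linear M -> mtens (breg L) M} := mklin inv_linear.

Lemma resolution_mtens_exact n : short_exact
  (mmap (rinc R n) (idfun : {linear M -> M}))
  (mmap (repi R n) (idfun : {linear M -> M})).
Proof. exact: mtens_exact (r_exact R n) (resolution_rsplit R n). Qed.

(* A chain map from Q to R (x)_L M lifting M ~ L (x)_L M, on syzygies. *)
Fixpoint comparison (n : nat) : {linear syz Q n -> mtens (syz R n) M} :=
  match n return {linear syz Q n -> mtens (syz R n) M} with
  | 0 => munit_inv
  | m.+1 => projT1 (cid (syz_lift_ex (comparison m) (rproj_projective Q m)
                           (r_exact Q m) (resolution_mtens_exact m)))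
  end.

Lemma comparisonP n : is_syz_lift (rinc Q n) (repi Q n)
  (mmap (rinc R n) (idfun : {linear M -> M})) (mmap (repi R n) (idfun : {linear M -> M}))
  (comparison n) (comparison n.+1).
Proof. exact: (projT2 (cid _)). Qed.

(* - (x)_L M on cocycles: Omega^n(M) -> Omega^n(L) (x) M -> L (x) M ~ M. *)
Definition actf (a : family R) : family Q :=
  fun n => munit M \o mmap (a n) (idfun : {linear M -> M}) \o comparison n.

Let cob_act n (f : {linear syz R n -> breg L}) : coboundary f ->
  coboundary (munit M \o mmap f (idfun : {linear M -> M}) \o comparison n).
Proof.
case: n f => [|n] f h.
  move=> x; change (munit M (mmap f idfun (mpure (breg1 L) x)) = 0).
  rewrite -[RHS](linear0 (munit M)); congr (munit M _); rewrite mmap_pureE h (morphD0 (f := fun y => mpure y _)) // => y z.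
  by rewrite mpureDl.
have [g hg] := h; have [u [_ hu]] := comparisonP n.
exists (munit M \o mmap g (idfun : {linear M -> M}) \o u) => x.
change (munit M (mmap f idfun (comparison n.+1 x)) =
    munit M (mmap g idfun (u (rinc Q n x)))).
rewrite -hu; congr (munit M _).
elim/mtens_ind: (comparison n.+1 x) => [y m|v w IH IH']; first by rewrite !mmap_pureE hg.
by rewrite !linearD IH IH'.
Qed.

Let actf_supp (a : cochain R) : fin_supp (actf (cval a)).
Proof. by have [N hN] := cval_supp a; exists N => n /hN; exact: cob_act. Qed.

Definition act (a : cochain R) : cochain Q := Cochain (actf_supp a).

(* The map HH^*(L) -> Ext^*_L(M, M) induced by - (x)_L M. *)
Definition hh_to_ext (q : ext R) : ext Q := ext_class (act (ext_repr q)).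

Lemma hh_to_ext_class a : hh_to_ext (ext_class a) = ext_class (act a).
Proof.
apply/ext_classP => n.
have h := ext_reprP a n.
set b := cval (ext_repr (ext_class a)) in h *.
have h' : coboundary (b n \- cval a n) by [].
apply: (cob_ext _ (cob_act h')) => x.
change (munit M (mmap (b n \- cval a n) idfun (comparison n x)) =
  munit M (mmap (b n) idfun (comparison n x)) -
  munit M (mmap (cval a n) idfun (comparison n x))).
rewrite -(linearB (munit M)); congr (munit M _).
elim/mtens_ind: (comparison n x) => [y m|v w IH IH'].
  rewrite !mmap_pureE; apply/eqP; rewrite -subr_eq0 opprB addrA -mpureDl /=.
  by rewrite subrK subrr.
by rewrite !linearD IH IH' addrACA.
Qed.

(* Ext^*_L(M, M) is a module over HH^*(L) = ext R through hh_to_ext. *)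
Definition annihilator : set (ext R) :=
  fun q => forall theta : ext Q, hh_to_ext q * theta = 0.
End Action.

Section Extensions.
Variables (k : fieldType) (L : algType k) (R : resolution (breg L)).

(* A representative Omega^n -> L of a homogeneous element of degree
   n = hdeg + 1.  The degree is positive because the extension E_eta involves
   Omega^(n-1). *)
Record hrep : Type :=
  HRep { hdeg : nat; hmap : {linear syz R hdeg.+1 -> breg L} }.

(* eta is homogeneous of degree (hdeg r).+1 and is the class of hmap r. *)
Definition represents (r : hrep) (eta : ext R) : Prop :=
  exists a : cochain R,
    [/\ ext_class a = eta, forall x, cval a (hdeg r).+1 x = hmap r x
      & forall m x, m != (hdeg r).+1 -> cval a m x = 0].

(* E_eta is the sequence 0 -> L -> middle r -> Omega^(n-1) -> 0 with maps
   alpha r and beta r. *)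
Definition middle (r : hrep) : lmodType (env L) :=
  pushout (hmap r) (rinc R (hdeg r)).
Definition alpha (r : hrep) : {linear breg L -> middle r} :=
  pushout_inl (hmap r) (rinc R (hdeg r)).

Let epi_inc n x : repi R n (rinc R n x) = 0.
Proof. by have [_ h _] := r_exact R n; apply/h; exists x. Qed.

Definition beta (r : hrep) : {linear middle r -> syz R (hdeg r)} :=
  pushout_desc (hmap r) (epi_inc (n := hdeg r)).

(* M_eta1 (x)_L ... (x)_L M_etat, bracketed to the right; the empty product
   is L. *)
Fixpoint middle_tens (s : seq hrep) : lmodType (env L) :=
  match s with
  | [::] => breg L
  | [:: r] => middle r
  | r :: s' => btens (middle r) (middle_tens s')
  end.

(* alpha_eta1 (x) ... (x) alpha_etat precomposed with L ~ L (x)_L ... (x)_L L. *)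
Fixpoint alpha_tens (s : seq hrep) : {linear breg L -> middle_tens s} :=
  match s return {linear breg L -> middle_tens s} with
  | [::] => idfun
  | r :: s' =>
      match s' return {linear breg L -> middle_tens s'} -> {linear breg L -> middle_tens (r :: s')} with
      | [::] => fun _ => alpha r
      | _ => fun g => bmap (alpha r) g \o bdiag L
      end (alpha_tens s')
  end.

Definition coker_tens (s : seq hrep) : lmodType (env L) := cok (alpha_tens s).
Definition beta_tens (s : seq hrep) : {linear middle_tens s -> coker_tens s} := cok_proj (alpha_tens s).

End Extensions.

Arguments annihilator {k L M} R Q _.

(* Main.v *)
Require Import Defs.
From HB Require Import structures.
From mathcomp Require Import all_boot all_algebra all_field.
From mathcomp Require Import boolp classical_sets.

(* E_eta (x) M is the pushout of 0 -> Omega^n (x) M -> P^(n-1) (x) M along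
   eta (x) M, so it splits exactly when eta (x) M extends to P^(n-1) (x) M.
   Since P (x)_L M is projective for P projective over L^e, the resolution
   R (x) M of M may replace Q, and this extension property says that the image
   of eta in Ext_L(M, M) vanishes; as HH^*(L) -> Ext_L(M, M) is a ring morphism,
   its kernel, the annihilator, is an ideal.  For several classes,
   alpha_(eta_1, ..., eta_t) (x) M is both
   (alpha_(eta_1) (x) 1) o (alpha_(eta_2, ..., eta_t) (x) M) and
   (1 (x) alpha_(eta_2, ..., eta_t) (x) M) o (alpha_(eta_1) (x) M), so it is a
   split monomorphism exactly when every alpha_(eta_i) (x) M is one. *)

Set Implicit Arguments.
Unset Strict Implicit.
Unset Printing Implicit Defensive.

Import GRing.Theory.
Local Open Scope ring_scope.

(** * Split sequences and direct summands *)

(** Preimages under [g] come from choice alone; [h \o s] is still linear, as [h] vanishes on the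
    kernel of [g] and so ignores which preimage was chosen. *)
Lemma factor_surj (A : pzRingType) (U V W : lmodType A) (g : {linear U -> V})
    (h : {linear U -> W}) : surj g -> (forall u, g u = 0 -> h u = 0) ->
  exists e : {linear V -> W}, forall u, e (g u) = h u.
Proof.
move=> g_surj gh; have [s sP] := choice g_surj.
have sK u : h (s (g u)) = h u.
  by apply/eqP; rewrite -subr_eq0 -linearB gh // linearB sP subrr.
have e_lin : linear (h \o s).
  move=> a x y; rewrite -(sP x) -(sP y) -linearP /= !sK.
  exact: linearP.
by exists (mklin e_lin).
Qed.

(** A retraction forces [f] to be injective, so it is enough to know exactness at [V] and [W], which
    the tensor product preserves. *)
Lemma split_exactP (A : pzRingType) (U V W : lmodType A) (f : {linear U -> V})
    (g : {linear V -> W}) :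
  (forall v, g v = 0 <-> exists u, f u = v) -> surj g ->
  split_short_exact f g <-> exists r : {linear V -> U}, cancel f r.
Proof.
move=> fg g_surj; have gf u : g (f u) = 0 by apply/fg; exists u.
split=> [[[f_inj _ _] [s sK]]|[r rK]].
  have ex v : exists u, f u = v - s (g v).
    by apply/fg; rewrite linearB sK subrr.
  have [r rP] := choice ex.
  have r_lin : linear r.
    move=> a x y; apply: f_inj; rewrite linearP !rP (linearP g) (linearP s).
    by rewrite scalerBr opprD addrACA.
  by exists (mklin r_lin) => u; apply: f_inj; rewrite [LHS]rP gf linear0 subr0.
split; first by split=> //; exact: can_inj rK.
(* This map vanishes on the image of [f], which is the kernel of [g]; its factor through [g] is the
   section. *)
have [s sP] : exists s : {linear W -> V}, forall v, s (g v) = (idfun \- (f \o r)) v.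
  apply: factor_surj => // v /fg[u <-].
  by rewrite /= rK subrr.
exists s => w; have [v <-] := g_surj w.
by rewrite sP /= linearB gf subr0.
Qed.

Lemma split_direct_summand (A : pzRingType) (U V W : lmodType A)
    (f : {linear U -> V}) (g : {linear V -> W}) :
  split_short_exact f g -> direct_summand U V.
Proof.
move=> [[f_inj fg _] [s sK]].
have gf u : g (f u) = 0 by apply/fg; exists u.
have e_lin : linear (fun x : (U * W)%type => f x.1 + s x.2).
  by move=> a x y /=; rewrite !linearP scalerDr addrACA.
exists W, (mklin e_lin).
have ex v : exists u, f u = v - s (g v).
  by apply/fg; rewrite linearB sK subrr.
have [r rP] := choice ex.
exists (fun v => (r v, g v)) => [[u w]|v] /=; last by rewrite rP subrK.
have gE : g (f u + s w) = w by rewrite linearD gf add0r sK.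
congr (_, _); last exact: gE.
by apply: f_inj; rewrite rP gE addrK.
Qed.

Lemma direct_summand_iso (A : pzRingType) (M U V : lmodType A)
    (i : {linear M -> U}) :
  bijective i -> direct_summand U V -> direct_summand M V.
Proof.
move=> i_bij [C [f f_bij]].
have j_lin : linear (fun x : (M * C)%type => (i x.1, x.2) : (U * C)%type).
  by move=> a x y; congr (_, _); rewrite /= linearP.
exists C, (f \o mklin j_lin); apply: bij_comp f_bij _.
have [i' iK i'K] := i_bij.
by exists (fun x => (i' x.1, x.2)) => -[x y] /=; rewrite ?iK ?i'K.
Qed.

(** * Right exactness of the tensor product with [M] *)

Lemma mtens_morph_ext (k : fieldType) (L : algType k) (X : lmodType (env L))
    (M : lmodType L) (G : zmodType) (f g : mtens X M -> G) :
  {morph f : t u / t + u} -> {morph g : t u / t + u} ->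
  (forall x m, f (mpure x m) = g (mpure x m)) -> f =1 g.
Proof. by move=> fD gD e; elim/mtens_ind => // t u; rewrite fD gD => -> ->. Qed.

Lemma mpure0l (k : fieldType) (L : algType k) (X : lmodType (env L))
    (M : lmodType L) (m : M) : mpure (0 : X) m = 0.
Proof. by apply: (morphD0 (f := fun x => mpure x m)) => x y; rewrite mpureDl. Qed.

Lemma mtens_right_exact (k : fieldType) (L : algType k)
    (X Y Z : lmodType (env L)) (M : lmodType L)
    (f : {linear X -> Y}) (g : {linear Y -> Z}) :
  (forall y, g y = 0 <-> exists x, f x = y) -> surj g ->
  let fM := mmap f (idfun : {linear M -> M}) in
  let gM := mmap g (idfun : {linear M -> M}) in
  (forall t, gM t = 0 <-> exists u, fM u = t) /\ surj gM.
Proof.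
move=> fg g_surj fM gM; have [s sP] := choice g_surj.
have gf x : g (f x) = 0 by apply/fg; exists x.
split; last first.
  elim/mtens_ind=> [z m|t u [t' <-] [u' <-]].
    by exists (mpure (s z) m); rewrite mmap_pureE sP.
  by exists (t' + u'); rewrite linearD.
(* A map [e] with [e \o gM] equal to the projection onto the cokernel of [fM] gives exactness in the
   middle. Its formula is balanced because another preimage of [z] changes the pure tensor only by
   an element of the image of [fM]. *)
have bal : @mbalanced k L Z M (cok fM) (fun z m => cok_proj fM (mpure (s z) m)).
  have eqmod y y' m : g y = g y' -> cok_proj fM (mpure y m) = cok_proj fM (mpure y' m).
    move=> e; have /fg[x xP] : g (y - y') = 0 by rewrite linearB e subrr.
    apply/cok_projP; exists (mpure x m); rewrite mmap_pureE xP.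
    by apply/eqP; rewrite subr_eq -mpureDl subrK.
  split=> [x y m|x m n|x b m].
  - by rewrite -linearD -mpureDl; apply: eqmod; rewrite linearD !sP.
  - by rewrite mpureDr linearD.
  - by rewrite -mpureA; apply: eqmod; rewrite linear_bract !sP.
pose e : mtens Z M -> cok fM := mlift (fun z m => cok_proj fM (mpure (s z) m)).
have eD : {morph e : t u / t + u} := mliftD bal.
have eg t : e (gM t) = cok_proj fM t.
  move: t; apply: mtens_morph_ext => [t u|t u|y m]; rewrite ?linearD ?eD //.
  rewrite mmap_pureE [LHS](mlift_pure _ _ bal).
  have /fg[x xP] : g (s (g y) - y) = 0 by rewrite linearB sP subrr.
  apply/cok_projP; exists (mpure x m); rewrite mmap_pureE xP.
  by apply/eqP; rewrite subr_eq -mpureDl subrK.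
move=> t; split=> [gt0|[u <-]].
  have : cok_proj fM t = cok_proj fM 0 by rewrite -eg gt0 (morphD0 eD) linear0.
  by move=> /cok_projP[u uP]; exists u; rewrite -uP subr0.
move: u; apply: mtens_morph_ext => [t' u|t' u|x m]; rewrite ?linearD ?addr0 //.
by rewrite !mmap_pureE gf mpure0l.
Qed.

(** * Associativity of the tensor product *)

Section Associativity.
Variables (k : fieldType) (L : algType k) (X Y : lmodType (env L)) (M : lmodType L).

Lemma blact_bpure a (x : X) (y : Y) : blact a (bpure x y) = bpure (blact a x) y.
Proof. by rewrite /blact bpureZ /bract epure1 scale1r. Qed.

Lemma bract_bpure (x : X) (y : Y) b : bract (bpure x y) b = bpure x (bract y b).
Proof. by rewrite {1}/bract bpureZ /blact epure1 scale1r. Qed.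

Lemma bpureDl (x x' : X) (y : Y) : bpure (x + x') y = bpure x y + bpure x' y.
Proof. exact: mpureDl. Qed.

Lemma bpureDr (x : X) (y y' : Y) : bpure x (y + y') = bpure x y + bpure x y'.
Proof. exact: mpureDr. Qed.

Lemma bpureA (x : X) (y : Y) b : bpure (bract x b) y = bpure x (blact b y).
Proof. exact: (@mpureA k L X (lres Y)). Qed.

(** Two successive lifts: in [X] and [Y] for fixed [m], then in [btens X Y] and [M]. *)
Lemma massoc_exists :
  exists f : {linear mtens (btens X Y) M -> mtens X (mtens Y M)},
    forall x y m, f (mpure (bpure x y) m) = mpure x (mpure y m).
Proof.
pose h (m : M) := fun (x : X) (y : lres Y) => mpure x (mpure (y : Y) m).
have hB m : mbalanced (h m).
  split=> [x x' y|x y y'|x b y]; rewrite /h; first by rewrite mpureDl.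
    by rewrite -mpureDr; congr mpure; exact: mpureDl.
  by rewrite mpureA mpureZ.
pose g (t : btens X Y) (m : M) : mtens X (mtens Y M) :=
  mlift (h m) (t : mtens X (lres Y)).
have gD m : {morph g^~ m : t u / t + u} := mliftD (hB m).
have gE x y m : g (bpure x y) m = mpure x (mpure y m) :=
    @mlift_pure k L X (lres Y) _ (h m) x y (hB m).
have gB : mbalanced g.
  split=> [t u m|t m n|t b m]; first exact: gD.
    elim/btens_ind: t => [x y|t u IH IH']; first by rewrite !gE -mpureDr -mpureDr.
    by rewrite !gD IH IH' addrACA.
  elim/btens_ind: t => [x y|t u IH IH'].
    by rewrite bract_bpure !gE mpureA.
  by rewrite (raDl (bimod_actions _)) !gD IH IH'.
have fD := mliftD gB.
have f_lin : linear (mlift g).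
  move=> a t u; rewrite fD; congr (_ + _).
  elim/mtens_ind: t => [t m|t v IH IH']; last by rewrite scalerDr !fD IH IH' scalerDr.
  rewrite mpureZ !(mlift_pure _ _ gB).
  elim/btens_ind: t => [x y|t v IH IH']; first by rewrite blact_bpure !gE mpureZ.
  by rewrite (laDr (bimod_actions _)) !gD IH IH' scalerDr.
exists (mklin f_lin) => x y m.
by rewrite [LHS](mlift_pure _ _ gB) gE.
Qed.

Lemma massoc_inv_exists :
  exists f : {linear mtens X (mtens Y M) -> mtens (btens X Y) M},
    forall x y m, f (mpure x (mpure y m)) = mpure (bpure x y) m.
Proof.
pose h (x : X) := fun (y : Y) (m : M) => mpure (bpure x y) m.
have hB x : mbalanced (h x).
  split=> [y y' m|y m n|y b m]; rewrite /h; first by rewrite bpureDr mpureDl.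
    by rewrite mpureDr.
  by rewrite -bract_bpure mpureA.
pose g (x : X) (u : mtens Y M) := mlift (h x) u.
have gD x : {morph g x : t u / t + u} := mliftD (hB x).
have gE x y m : g x (mpure y m) = mpure (bpure x y) m := mlift_pure y m (hB x).
have gB : mbalanced g.
  split=> [x x' u|x u v|x b u]; last 1 first.
  - elim/mtens_ind: u => [y m|t u IH IH']; first by rewrite mpureZ !gE bpureA.
    by rewrite scalerDr !gD IH IH'.
  - elim/mtens_ind: u => [y m|t u IH IH']; first by rewrite !gE bpureDl mpureDl.
    by rewrite !gD IH IH' addrACA.
  - exact: gD.
have fD := mliftD gB.
have f_lin : linear (mlift g).
  move=> a t u; rewrite fD; congr (_ + _).
  elim/mtens_ind: t => [x v|t v IH IH']; last by rewrite scalerDr !fD IH IH' scalerDr.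
  rewrite mpureZ !(mlift_pure _ _ gB).
  elim/mtens_ind: v => [y m|t v IH IH']; first by rewrite !gE mpureZ blact_bpure.
  by rewrite !gD IH IH' scalerDr.
exists (mklin f_lin) => x y m.
by rewrite [LHS](mlift_pure _ _ gB) gE.
Qed.
End Associativity.

(** * Monomorphisms that split after tensoring with [M] *)

(** For the first map of a right exact sequence, this amounts to the splitting of the tensored
    sequence, by [mtens_right_exact] and [split_exactP]. *)
Definition msplit (k : fieldType) (L : algType k) (M : lmodType L)
    (X Y : lmodType (env L)) (f : {linear X -> Y}) : Prop :=
  exists r : {linear mtens Y M -> mtens X M},
    cancel (mmap f (idfun : {linear M -> M})) r.

Section SplitTensor.
Variables (k : fieldType) (L : algType k) (M : lmodType L).

Lemma bpure_breg (a b : breg L) : bpure a b = bdiag L ((a * b : L) : breg L).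
Proof.
rewrite [RHS](_ : _ = bpure ((a * b : L) : breg L) (breg1 L)) //.
have -> : (a * b : L) = bract a (b : L) by rewrite /bract breg_scale mul1r.
rewrite bpureA; congr bpure.
by rewrite /blact breg_scale !mulr1.
Qed.

Lemma mpure_breg (a : breg L) (m : M) : mpure a m = mpure (breg1 L) ((a : L) *: m).
Proof. by rewrite -mpureA /bract breg_scale !mul1r. Qed.

Lemma munitK : cancel (munit M) (munit_inv M).
Proof.
apply: mtens_morph_ext => [t u|//|a m]; first by rewrite !linearD.
by rewrite munitE [RHS]mpure_breg.
Qed.

Lemma munit_invK : cancel (munit_inv M) (munit M).
Proof. by move=> m; rewrite [LHS]munitE scale1r. Qed.

Lemma msplit_eq (X Y : lmodType (env L)) (f : {linear X -> Y})
    (r : {linear mtens Y M -> mtens X M}) :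
  (forall x m, r (mpure (f x) m) = mpure x m) -> msplit M f.
Proof.
move=> h; exists r; apply: mtens_morph_ext => [t u|//|x m]; first by rewrite !linearD.
by rewrite mmap_pureE h.
Qed.

Lemma msplit_bmap (X Y : lmodType (env L)) (f : {linear breg L -> X})
    (g : {linear breg L -> Y}) :
  msplit M (bmap f g \o bdiag L) <-> msplit M f /\ msplit M g.
Proof.
have [A AE] := massoc_exists X Y M; have [B BE] := massoc_inv_exists X Y M.
split=> [[r rK]|[[r rK] [s sK]]].
  (* On tensors [f x (x) g y (x) m] the retraction [r] multiplies [x] and [y]; inserting [g 1] (via
     [i]) or [f 1] (via [j]) gives the two retractions. *)
  have rE x y m : r (mpure (bpure (f x) (g y)) m) = mpure ((x * y : L) : breg L) m.
    rewrite -[RHS]rK mmap_pureE; congr (r (mpure _ _)).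
    rewrite -[RHS]/(bmap f g (bdiag L ((x * y : L) : breg L))).
    by rewrite -bpure_breg bmap_pureE.
  split.
    pose i : {linear M -> mtens Y M} := mmap g (idfun : {linear M -> M}) \o munit_inv M.
    apply: (@msplit_eq _ _ f (r \o B \o mmap (idfun : {linear X -> X}) i)) => x m.
    rewrite -[LHS]/(r (B (mmap (idfun : {linear X -> X}) i (mpure (f x) m)))).
    by rewrite mmap_pureE [i m]mmap_pureE BE [LHS]rE mulr1.
  pose j : {linear mtens Y M -> mtens X (mtens Y M)} :=
    mmap f (idfun : {linear mtens Y M -> mtens Y M}) \o munit_inv (mtens Y M).
  apply: (@msplit_eq _ _ g (r \o B \o j)) => x m.
  rewrite -[LHS]/(r (B (j (mpure (g x) m)))).
  by rewrite [j _]mmap_pureE BE [LHS]rE mul1r.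
(* Conversely, [p] contracts [g 1 (x) m] to [m], after which [r] undoes [f]. *)
pose p : {linear mtens Y M -> M} := munit M \o s.
apply: (@msplit_eq _ _ _ (r \o mmap (idfun : {linear X -> X}) p \o A)) => a m.
rewrite -[LHS]/(r (mmap (idfun : {linear X -> X}) p
  (A (mpure (bmap f g (bpure a (breg1 L))) m)))).
rewrite bmap_pureE AE mmap_pureE.
have -> : p (mpure (g (breg1 L)) m) = m.
  have := sK (mpure (breg1 L) m); rewrite mmap_pureE /p /= => ->.
  exact: munit_invK.
by have := rK (mpure a m); rewrite mmap_pureE.
Qed.

Lemma msplit_alpha_tens (R : resolution (breg L)) (s : seq (hrep R)) :
  msplit M (alpha_tens s) <->
  forall r i, (i < size s)%N -> msplit M (alpha (nth r s i)).
Proof.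
elim: s => [|r [|r' s] IH].
- by split=> // _; exact: (@msplit_eq _ _ _ idfun).
(* A single factor is a separate case: [middle_tens [:: r]] is [middle r], not a tensor product with
   [L]. *)
- by split=> [h q [|i]|h] //; exact: (h r 0).
change (alpha_tens (r :: r' :: s)) with
  (bmap (alpha r) (alpha_tens (r' :: s)) \o bdiag L : {linear _ -> _}).
rewrite msplit_bmap IH; split=> [[h h'] q [|i] //|h]; first exact: h'.
by split=> [|q i]; [exact: (h r 0) | exact: (h q i.+1)].
Qed.
End SplitTensor.

(** * Projectivity of [P (x)_L M] over [L] *)

Section KHom.
Variables (k : fieldType) (L : algType k).

Lemma scaleA_comm (V : lmodType L) (a : L) (c : k) (v : V) :
  a *: ((c *: 1 : L) *: v) = (c *: 1 : L) *: (a *: v).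
Proof. by rewrite !scalerA -scalerAr -scalerAl mulr1 mul1r. Qed.

Variable M : lmodType L.

(** Hom_k(M, V), where [k] acts through the elements [c *: 1] of [L], since an [lmodType L] carries
    no separate [k]-structure. *)
Record khom (V : lmodType L) : Type := KHom {
  khom_fun :> M -> V;
  khomD : {morph khom_fun : x y / x + y};
  khomZ : forall (c : k) m, khom_fun ((c *: 1 : L) *: m) = (c *: 1 : L) *: khom_fun m }.

HB.instance Definition _ V := gen_eqMixin (khom V).
HB.instance Definition _ V := gen_choiceMixin (khom V).

Lemma khomP V (f g : khom V) : f =1 g -> f = g.
Proof.
case: f g => [f fD fZ] [g gD gZ] /= /funext fg; case: g / fg in gD gZ *.
by congr KHom; exact: Prop_irrelevance.
Qed.

Section Structure.
Variable V : lmodType L.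
Implicit Types f g : khom V.

Fact khom0_subproof (c : k) (m : M) : 0 = (c *: 1 : L) *: 0 :> V.
Proof. by rewrite scaler0. Qed.
Definition khom0 : khom V :=
  @KHom V (fun=> 0) (fun _ _ => esym (addr0 0)) khom0_subproof.

Fact khom_add_subproof f g : {morph (fun m => f m + g m) : x y / x + y} /\
  forall (c : k) m, f ((c *: 1 : L) *: m) + g ((c *: 1 : L) *: m) =
    (c *: 1 : L) *: (f m + g m).
Proof.
by split=> [x y|c m]; rewrite ?khomD ?khomZ ?scalerDr // addrACA.
Qed.
Definition khom_add f g : khom V :=
  KHom (khom_add_subproof f g).1 (khom_add_subproof f g).2.

Fact khom_opp_subproof f : {morph (fun m => - f m) : x y / x + y} /\
  forall (c : k) m, - f ((c *: 1 : L) *: m) = (c *: 1 : L) *: - f m.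
Proof. by split=> [x y|c m]; rewrite ?khomD ?khomZ ?scalerN // opprD. Qed.
Definition khom_opp f : khom V :=
  KHom (khom_opp_subproof f).1 (khom_opp_subproof f).2.

Fact khom_addA : associative khom_add.
Proof. by move=> f g h; apply: khomP => m; exact: addrA. Qed.
Fact khom_addC : commutative khom_add.
Proof. by move=> f g; apply: khomP => m; exact: addrC. Qed.
Fact khom_add0 : left_id khom0 khom_add.
Proof. by move=> f; apply: khomP => m; exact: add0r. Qed.
Fact khom_addN : left_inverse khom0 khom_opp khom_add.
Proof. by move=> f; apply: khomP => m; exact: addNr. Qed.
HB.instance Definition _ :=
  GRing.isZmodule.Build (khom V) khom_addA khom_addC khom_add0 khom_addN.

Fact khom_lact_subproof (a : L) f : {morph (fun m => a *: f m) : x y / x + y} /\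
  forall (c : k) m, a *: f ((c *: 1 : L) *: m) = (c *: 1 : L) *: (a *: f m).
Proof.
by split=> [x y|c m]; [rewrite khomD scalerDr | rewrite khomZ scaleA_comm].
Qed.
Definition khom_lact a f : khom V :=
  KHom (khom_lact_subproof a f).1 (khom_lact_subproof a f).2.

Fact khom_ract_subproof f (b : L) : {morph (fun m => f (b *: m)) : x y / x + y} /\
  forall (c : k) m, f (b *: ((c *: 1 : L) *: m)) = (c *: 1 : L) *: f (b *: m).
Proof.
by split=> [x y|c m]; [rewrite scalerDr khomD | rewrite scaleA_comm khomZ].
Qed.
Definition khom_ract f b : khom V :=
  KHom (khom_ract_subproof f b).1 (khom_ract_subproof f b).2.

(** The structure is [(a f b) m = a f (b m)]; linearity over [k] is what the last axiom, [laraZ],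
    asks for. *)
Lemma khom_axioms : bimod_axioms khom_lact khom_ract.
Proof.
split=> [a f g|f a b|a b f|f|b f g|f a b|f a b|f|a f b|c f];
  apply: khomP => m //=.
- exact: scalerDr.
- exact: scalerDl.
- by rewrite scalerA.
- exact: scale1r.
- by rewrite scalerDl khomD.
- by rewrite scalerA.
- by rewrite scale1r.
- by rewrite khomZ.
Qed.
HB.instance Definition _ := GRing.Zmodule_isLmodule.Build (env L) (khom V)
  (bscaleA khom_axioms) (bscale1 khom_axioms) (bscaleDr khom_axioms)
  (bscaleDl khom_axioms).

Lemma khom_scale a b f m : (epure a b *: f) m = a *: f (b *: m).
Proof. by rewrite [epure a b *: f](bscale_pure khom_axioms). Qed.
End Structure.

Section Postcomposition.
Variables (U V : lmodType L) (p : {linear U -> V}).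

Fact khom_post_subproof (f : khom U) : {morph (fun m => p (f m)) : x y / x + y} /\
  forall (c : k) m, p (f ((c *: 1 : L) *: m)) = (c *: 1 : L) *: p (f m).
Proof. by split=> [x y|c m]; rewrite (khomD, khomZ) (linearD, linearZ_LR). Qed.
Definition khom_post_fun (f : khom U) : khom V :=
  KHom (khom_post_subproof f).1 (khom_post_subproof f).2.

Fact khom_post_linear : linear khom_post_fun.
Proof.
have D f g : khom_post_fun (f + g) = khom_post_fun f + khom_post_fun g.
  by apply: khomP => m; exact: linearD.
move=> t f g; rewrite D; congr (_ + _).
elim/env_ind: t => [a b|t u IH IH']; last by rewrite !scalerDl D IH IH'.
by apply: khomP => m; rewrite khom_scale /= khom_scale linearZ_LR.
Qed.
Definition khom_post : {linear khom U -> khom V} := mklin khom_post_linear.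
End Postcomposition.

Section Restriction.
Variable V : lmodType L.
Definition kmod : Type := V.
HB.instance Definition _ := GRing.Zmodule.on kmod.
Let sc (c : k) (v : kmod) : kmod := (c *: 1 : L) *: (v : V).
Let scA a b v : sc a (sc b v) = sc (a * b) v.
Proof. by rewrite /sc scalerA -scalerAl mul1r scalerA. Qed.
Let sc1 : left_id 1 sc.
Proof. by move=> v; rewrite /sc !scale1r. Qed.
Let scDr : right_distributive sc +%R.
Proof. by move=> c u v; rewrite /sc scalerDr. Qed.
Let scDl v : {morph sc^~ v : a b / a + b}.
Proof. by move=> a b; rewrite /sc !scalerDl. Qed.
HB.instance Definition _ :=
  GRing.Zmodule_isLmodule.Build k kmod scA sc1 scDr scDl.
End Restriction.

(** Over the field [k] the map [p] has a linear section; composing with it gives preimages. *)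
Lemma khom_post_surj (U V : lmodType L) (p : {linear U -> V}) :
  surj p -> surj (khom_post p).
Proof.
move=> p_surj; have p_lin : linear (p : kmod U -> kmod V).
  by move=> c x y; rewrite linearD; congr (_ + _); exact: (linearZ_LR p).
have [s sK] := @linear_section _ _ _ (mklin p_lin) p_surj.
move=> f; have sf : {morph (fun m => s (f m) : U) : x y / x + y} /\
    forall (c : k) m, s (f ((c *: 1 : L) *: m)) = (c *: 1 : L) *: (s (f m) : U) :> U.
  split=> [x y|c m]; first by rewrite khomD; exact: (linearD s).
  by rewrite khomZ; exact: (linearZ_LR s).
by exists (KHom sf.1 sf.2); apply: khomP => m; exact: sK.
Qed.

(* Tensor-hom adjunction: Hom_L(P (x)_L M, V) = Hom_(L^e)(P, Hom_k(M, V)), and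
   V |-> Hom_k(M, V) preserves surjections. *)
Lemma mtens_projective (P : lmodType (env L)) :
  projective P -> projective (mtens P M).
Proof.
move=> P_proj U V p f p_surj.
have Ff x : {morph (fun m => f (mpure x m)) : m n / m + n} /\
    forall (c : k) m, f (mpure x ((c *: 1 : L) *: m)) = (c *: 1 : L) *: f (mpure x m).
  split=> [m n|c m]; first by rewrite mpureDr linearD.
  by rewrite -linearZ_LR mpureZ (laraZ (bimod_actions P)) mpureA.
pose F x : khom V := KHom (Ff x).1 (Ff x).2.
have FD x y : F (x + y) = F x + F y.
  by apply: khomP => m; rewrite /= mpureDl linearD.
have F_lin : linear F.
  move=> t x y; rewrite FD; congr (_ + _).
  elim/env_ind: t => [a b|t u IH IH']; last by rewrite !scalerDl FD IH IH'.
  apply: khomP => m; rewrite khom_scale /= -linearZ_LR mpureZ -mpureA.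
  by rewrite epureE (laraA (bimod_actions P)).
have [G GP] := P_proj _ _ _ (mklin F_lin) (khom_post_surj p_surj).
have GB : @mbalanced k L P M U (fun x m => G x m).
  split=> [x y m|x m n|x b m]; [by rewrite linearD|exact: khomD|].
  by rewrite linear_bract /bract khom_scale scale1r.
have hD := mliftD GB.
have h_lin : linear (mlift (fun x m => G x m)).
  move=> a t u; rewrite hD; congr (_ + _).
  elim/mtens_ind: t => [x m|t v IH IH']; last by rewrite scalerDr !hD IH IH' scalerDr.
  by rewrite mpureZ !(mlift_pure _ _ GB) linear_blact /blact khom_scale scale1r.
exists (mklin h_lin); apply: mtens_morph_ext => [t u|t u|x m].
- by rewrite /= hD linearD.
- exact: linearD.
- have -> : mklin h_lin (mpure x m) = G x m := mlift_pure _ _ GB.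
  exact: (congr1 (fun g : khom V => g m) (GP x)).
Qed.
End KHom.

(** * Maps that factor through projectives, and their lifts to syzygies *)

Section Lifts.
Variable A : pzRingType.

(** The maps that vanish stably. Unlike [coboundary] this names no resolution, so it can be used
    between [Q] and [R (x) M]. *)
Definition proj_factor (O O' : lmodType A) (f : O -> O') : Prop :=
  exists (P : lmodType A) (j : {linear O -> P}) (u : {linear P -> O'}),
    projective P /\ forall x, f x = u (j x).

(** Lift [u] along [p'] to [v]. Then [h - v \o j \o p] lands in the kernel of [p'], which gives [w];
    on [K] the correction disappears because [p \o i = 0]. *)
Lemma lift_proj_factor (K P O K' P' O' : lmodType A)
    (i : {linear K -> P}) (p : {linear P -> O})
    (i' : {linear K' -> P'}) (p' : {linear P' -> O'})
    (f : {linear O -> O'}) (g : {linear K -> K'}) :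
  short_exact i p -> short_exact i' p' -> is_syz_lift i p i' p' f g ->
  proj_factor f -> exists w : {linear P -> K'}, forall x, g x = w (i x).
Proof.
move=> [_ ip _] [i'_inj ip' p'_surj] [h [hf hg]] [P0 [j [u [P0_proj fE]]]].
have [v vP] := P0_proj _ _ _ u p'_surj.
have pi0 x : p (i x) = 0 by apply/ip; exists x.
have ex x : exists y, i' y = h x - v (j (p x)).
  by apply/ip'; rewrite linearB hf fE vP subrr.
have [w wP] := choice ex.
have w_lin : linear w.
  move=> a x y; apply: i'_inj; rewrite linearP !wP linearP (linearP p).
  by rewrite (linearP j) (linearP v) scalerBr opprD addrACA.
exists (mklin w_lin) => x; apply: i'_inj.
by rewrite hg [RHS]wP pi0 (linear0 j) (linear0 v) subr0.
Qed.

Lemma coboundary_proj_factor (X : lmodType A) (Q : resolution X) (Y : lmodType A)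
    n (f : syz Q n -> Y) : coboundary f -> proj_factor f.
Proof.
case: n f => [|n] f fb.
  (* In degree 0 a coboundary is zero, so any projective serves. *)
  exists (rproj Q 0), \0, \0; split=> [|x]; first exact: rproj_projective.
  exact: fb.
have [u fE] := fb; exists (rproj Q n), (rinc Q n), u.
by split=> //; exact: rproj_projective.
Qed.

Section Operations.
Variables (K P O K' P' O' : lmodType A).
Variables (i : {linear K -> P}) (p : {linear P -> O}).
Variables (i' : {linear K' -> P'}) (p' : {linear P' -> O'}).

Lemma is_syz_liftB (f f1 : {linear O -> O'}) (g g1 : {linear K -> K'}) :
  is_syz_lift i p i' p' f g -> is_syz_lift i p i' p' f1 g1 ->
  is_syz_lift i p i' p' (f \- f1) (g \- g1).
Proof.
move=> [h [hf hg]] [h1 [hf1 hg1]]; exists (h \- h1); split=> x /=.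
  by rewrite linearB hf hf1.
by rewrite linearB hg hg1.
Qed.

Lemma is_syz_lift_comp (K2 P2 O2 : lmodType A)
    (i2 : {linear K2 -> P2}) (p2 : {linear P2 -> O2})
    (f : {linear O' -> O2}) (g : {linear K' -> K2})
    (f1 : {linear O -> O'}) (g1 : {linear K -> K'}) :
  is_syz_lift i' p' i2 p2 f g -> is_syz_lift i p i' p' f1 g1 ->
  is_syz_lift i p i2 p2 (f \o f1) (g \o g1).
Proof.
move=> [h [hf hg]] [h1 [hf1 hg1]]; exists (h \o h1).
by split=> x /=; rewrite ?hf ?hf1 ?hg ?hg1.
Qed.
End Operations.
End Lifts.

(** * Comparison of the resolutions [Q] and [R (x) M] *)

Section Comparison.
Variables (k : fieldType) (L : algType k) (M : lmodType L).
Variables (R : resolution (breg L)) (Q : resolution M).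

Local Notation idM := (idfun : {linear M -> M}).

Lemma mmapD (X Y : lmodType (env L)) (f g : {linear X -> Y}) t :
  mmap (f \+ g) idM t = mmap f idM t + mmap g idM t.
Proof.
move: t; apply: mtens_morph_ext => [t u|t u|x m]; first exact: linearD.
  by rewrite !linearD addrACA.
by rewrite !mmap_pureE mpureDl.
Qed.

Lemma mmap0 (X Y : lmodType (env L)) (f : {linear X -> Y}) t :
  (forall x, f x = 0) -> mmap f idM t = 0.
Proof.
move=> f0; elim/mtens_ind: t => [x m|t u IH IH'].
  by rewrite mmap_pureE f0 mpure0l.
by rewrite linearD IH IH' addr0.
Qed.

(** A chain map opposite to [comparison]; it exists because the modules [P^n (x)_L M] are
    projective. *)
Fixpoint cocomparison (n : nat) : {linear mtens (syz R n) M -> syz Q n} :=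
  match n return {linear mtens (syz R n) M -> syz Q n} with
  | 0 => munit M
  | m.+1 => projT1 (cid (syz_lift_ex (cocomparison m)
               (mtens_projective (rproj_projective R m))
               (resolution_mtens_exact M R m) (r_exact Q m)))
  end.

Lemma cocomparisonP n : is_syz_lift (mmap (rinc R n) idM) (mmap (repi R n) idM)
  (rinc Q n) (repi Q n) (cocomparison n) (cocomparison n.+1).
Proof. exact: (projT2 (cid _)). Qed.

(** The composite of the two chain maps lifts the identity of [L (x)_L M]. Its difference [D] from
    the identity is therefore 0 at the start and, by induction, factors through a projective in
    every degree. *)
Lemma comparison_homotopy n :
  exists w : {linear mtens (rproj R n) M -> mtens (syz R n.+1) M},
    forall x, comparison R Q n.+1 (cocomparison n.+1 x) - x =
      w (mmap (rinc R n) idM x).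
Proof.
have exR m := resolution_mtens_exact M R m.
pose D m : {linear mtens (syz R m) M -> mtens (syz R m) M} :=
  (comparison R Q m \o cocomparison m) \- idfun.
have D_lift m : is_syz_lift (mmap (rinc R m) idM) (mmap (repi R m) idM)
    (mmap (rinc R m) idM) (mmap (repi R m) idM) (D m) (D m.+1).
  apply: is_syz_liftB; last by exists idfun.
  exact: is_syz_lift_comp (comparisonP R Q m) (cocomparisonP m).
have D_factor m : proj_factor (D m).
  elim: m => [|m IH].
    exists (rproj Q 0), \0, \0; split=> [|x]; first exact: rproj_projective.
    apply/eqP; rewrite subr_eq0; apply/eqP; exact: munitK.
  have [w wP] := lift_proj_factor (exR m) (exR m) (D_lift m) IH.
  exists (mtens (rproj R m) M), (mmap (rinc R m) idM), w; split=> //.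
  exact: mtens_projective (rproj_projective R m).
exact: lift_proj_factor (exR n) (exR n) (D_lift n) (D_factor n).
Qed.

(** Moves the coboundary condition from [Q] to [R (x) M], where the pushout defining [M_eta]
    lives. *)
Lemma comparison_coboundary (N : lmodType L) n
    (f : {linear mtens (syz R n.+1) M -> N}) :
  @coboundary _ _ Q N n.+1 (f \o comparison R Q n.+1) <->
  exists e : {linear mtens (rproj R n) M -> N},
    forall x, f x = e (mmap (rinc R n) idM x).
Proof.
split=> [[g gP]|[e eP]]; last first.
  have [h [_ hP]] := comparisonP R Q n.
  by exists (e \o h) => x; rewrite /= eP hP.
have [w wP] := comparison_homotopy n; have [h [_ hP]] := cocomparisonP n.
(* By the homotopy, [f] is [f \o comparison \o cocomparison] minus [f \o w] on the image of
   [rinc (x) M]; the first term extends as [g \o h]. *)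
exists ((g \o h) \- (f \o w)) => x.
by rewrite /= -wP -hP linearB -gP opprB addrC subrK.
Qed.


(** * The pushout sequences [E_eta] *)

(** Exposes the pushout as a cokernel with projection [q], through which both of its maps are
    computed. *)
Lemma pushoutP (A : pzRingType) (K Y P W : lmodType A) (f : {linear K -> Y})
    (i : {linear K -> P}) (p : {linear P -> W}) (pi0 : forall x, p (i x) = 0) :
  exists (s : {linear K -> (Y * P)%type}) (q : {linear (Y * P)%type -> pushout f i}),
    [/\ forall x, s x = (f x, - i x),
        (forall v, q v = 0 <-> exists x, s x = v) /\ surj q,
        forall y, pushout_inl f i y = q (y, 0)
      & forall v, pushout_desc f pi0 (q v) = p v.2].
Proof.
have s_lin : linear (fun x => (f x, - i x) : (Y * P)%type).
  by move=> a x y; congr (_, _); rewrite /= linearP // opprD scalerN.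
pose q : {linear (Y * P)%type -> pushout f i} := cok_proj _.
exists (mklin s_lin), q; split; [by []| |by []|exact: cok_liftE].
split; last exact: cok_surj.
move=> v; rewrite -(linear0 q); split=> [/cok_projP[x xP]|[x <-]].
  by exists x; rewrite -[RHS]subr0.
by apply/cok_projP; exists x; rewrite subr0.
Qed.

Lemma msplit_alpha (r : hrep R) :
  msplit M (alpha r) <->
  @coboundary _ _ Q M (hdeg r).+1
    (munit M \o mmap (hmap r) idM \o comparison R Q (hdeg r).+1).
Proof.
rewrite (comparison_coboundary (munit M \o mmap (hmap r) idM)).
have pi0 x : repi R (hdeg r) (rinc R (hdeg r) x) = 0.
  by have [_ h _] := r_exact R (hdeg r); apply/h; exists x.
have [s [q [sE [sq q_surj] alphaE _]]] := pushoutP (hmap r) pi0.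
have q_inc x : q (0, rinc R (hdeg r) x) = alpha r (hmap r x).
  apply/eqP; rewrite eq_sym -subr_eq0 [alpha r _]alphaE -linearB; apply/eqP/sq.
  by exists x; rewrite sE; congr (_, _); rewrite /= ?subr0 ?sub0r.
have [sqM qM_surj] := mtens_right_exact M sq q_surj.
split=> [[u uK]|[e eP]].
  (* [j] is the structure map of the pushout on [P^(n-1)]; followed by the retraction [u], it
     extends [hmap r (x) M]. *)
  have j_lin : linear (fun y : rproj R (hdeg r) => q (0, y)).
    by move=> a x y; rewrite -(linearP q); congr (q _); congr (_, _); rewrite /= scaler0 addr0.
  have jE x : mklin j_lin (rinc R (hdeg r) x) = alpha r (hmap r x) := q_inc x.
  exists (munit M \o u \o mmap (mklin j_lin) idM); elim/mtens_ind => [x m|t v IH IH'].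
    rewrite -[RHS]/(munit M (u (mmap (mklin j_lin) idM
      (mmap (rinc R (hdeg r)) idM (mpure x m))))).
    rewrite -[LHS]/(munit M (mmap (hmap r) idM (mpure x m))).
    by rewrite !mmap_pureE jE -[in LHS](uK (mpure _ _)) mmap_pureE.
  by rewrite !linearD IH IH'.
pose fs : {linear (breg L * rproj R (hdeg r))%type -> breg L} := fst.
pose sn : {linear (breg L * rproj R (hdeg r))%type -> rproj R (hdeg r)} := snd.
(* Conversely, [h] is the identity on the summand [L] and [e] on the other one; it vanishes on the
   relations [(hmap r x, - rinc x)], so it descends to a retraction [u]. *)
have [h hE] : exists h : {linear mtens (breg L * rproj R (hdeg r))%type M ->
    mtens (breg L) M},
    forall a y m, h (mpure (a, y) m) = mpure a m + munit_inv M (e (mpure y m)).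
  exists (mmap fs idM \+ (munit_inv M \o e \o mmap sn idM)) => a y m.
  rewrite -[LHS]/(mmap fs idM (mpure (a, y) m) +
    munit_inv M (e (mmap sn idM (mpure (a, y) m)))).
  by rewrite !mmap_pureE.
have [u uP] : exists u : {linear mtens (middle r) M -> mtens (breg L) M},
    forall t, u (mmap q idM t) = h t.
  apply: factor_surj => // t /sqM[v <-]; elim/mtens_ind: v => [x m|v w IH IH'].
    rewrite mmap_pureE sE hE (balancedNl _ _ (mpure_balanced _ _)).
    rewrite (linearN e) (linearN (munit_inv M)) -(mmap_pureE (rinc R (hdeg r)) idM) -eP.
    rewrite -[munit_inv M _]/(munit_inv M (munit M (mmap (hmap r) idM (mpure x m)))).
    by rewrite munitK mmap_pureE subrr.
  by rewrite !linearD IH IH' addr0.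
apply: (@msplit_eq _ _ _ _ _ _ u) => a m.
by rewrite [alpha r a]alphaE -(mmap_pureE q idM) uP hE mpure0l !linear0 addr0.
Qed.
Lemma middle_exact (r : hrep R) :
  (forall v, beta r v = 0 <-> exists x, alpha r x = v) /\ surj (beta r).
Proof.
have [inc_inj ex_ p_surj] := r_exact R (hdeg r).
have pi0 x : repi R (hdeg r) (rinc R (hdeg r) x) = 0 by apply/ex_; exists x.
have [s [q [sE [sq q_surj] alphaE betaE]]] := pushoutP (hmap r) pi0.
(* [beta] contains its own proof that [repi \o rinc] is 0, hence the appeal to proof irrelevance. *)
have betaE' v : beta r (q v) = repi R (hdeg r) v.2.
  by rewrite -betaE /beta; congr (pushout_desc _ _ (q v)); exact: Prop_irrelevance.
split=> [v|y]; last by have [x <-] := p_surj y; exists (q (0, x)); rewrite betaE'.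
have [[a y] <-] := q_surj v; rewrite betaE' ex_; split=> [[x xP]|[b bP]].
  (* The pushout relation at [x] turns [(a, rinc x)] into [(a + hmap r x, 0)]. *)
  exists (a + hmap r x); rewrite [alpha r _]alphaE.
  apply/eqP; rewrite -subr_eq0 -(linearB q); apply/eqP/sq; exists x.
  by rewrite sE; congr (_, _); rewrite /= ?sub0r ?xP // addrC addKr.
have /sq[x] : q ((a, y) - (b, 0)) = 0 by rewrite linearB -bP [alpha r b]alphaE subrr.
rewrite sE => -[_ /= e]; exists (- x); rewrite linearN e.
by rewrite subr0.
Qed.
End Comparison.

(** * The annihilator as the kernel of a ring morphism *)

Section Annihilator.
Variables (k : fieldType) (L : algType k) (M : lmodType L).
Variables (R : resolution (breg L)) (Q : resolution M).

Local Notation idM := (idfun : {linear M -> M}).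

(** Both composites lift those for the preceding [n] and [j]. Their difference thus lifts a
    coboundary, which factors through a projective, and is again a coboundary. *)
Lemma comparison_chain (a : Defs.family R) n j :
  @coboundary _ _ Q (mtens (syz R j) M) n (fun x =>
    mmap (chain a n j) idM (comparison R Q n x) -
    comparison R Q j (chain (actf Q a) n j x)).
Proof.
elim: j n => [|j IH] n.
  apply: (cob_ext _ (@cob0 _ _ Q _ _)) => x; apply/esym/eqP; rewrite subr_eq0.
  by apply/eqP/esym; exact: munitK.
case: n => [|n].
  (* Chains from degree 0 to degree [j.+1] are zero by definition. *)
  by move=> x; rewrite mmap0 // (linear0 (comparison R Q j.+1)) subrr.
have [h [hf hg]] := nextP (chain a n j).
have mmap_next : is_syz_lift (mmap (rinc R n) idM) (mmap (repi R n) idM)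
    (mmap (rinc R j) idM) (mmap (repi R j) idM)
    (mmap (chain a n j) idM) (mmap (chain a n.+1 j.+1) idM).
  exists (mmap h idM); split; elim/mtens_ind => [x m|t u IHt IHu];
    rewrite ?mmap_pureE ?hf ?hg // !linearD IHt IHu //.
have diff_lift := is_syz_liftB
  (is_syz_lift_comp mmap_next (comparisonP R Q n))
  (is_syz_lift_comp (comparisonP R Q j) (nextP (chain (actf Q a) n j))).
exact: lift_proj_factor (r_exact Q n) (resolution_mtens_exact M R j) diff_lift
  (coboundary_proj_factor (IH n)).
Qed.

Lemma mmap_mulf (b a : Defs.family R) n t :
  mmap (Defs.mulf b a n) idM t =
  \sum_(j < n.+1) mmap (b j) idM (mmap (chain a n j) idM t).
Proof.
elim/mtens_ind: t => [x m|t u IH IH'].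
  rewrite mmap_pureE -[Defs.mulf b a n x]/(mulf_fun b a x) /mulf_fun.
  rewrite (big_morph _ (fun y z => mpureDl y z m) (mpure0l _ m)).
  by under [RHS]eq_bigr do rewrite !mmap_pureE.
rewrite linearD IH IH' -big_split; apply: eq_bigr => j _.
by rewrite !linearD.
Qed.

Lemma hh_to_extM (p q : ext R) :
  hh_to_ext Q (p * q) = hh_to_ext Q p * hh_to_ext Q q.
Proof.
rewrite -(ext_reprK p) -(ext_reprK q).
set b := ext_repr p; set a := ext_repr q.
rewrite -[ext_class b * _]/(ext_mul _ _) -[RHS]/(ext_mul _ _) ext_mulE.
rewrite !hh_to_ext_class ext_mulE; apply/ext_classP => n.
pose f (j : 'I_n.+1) : {linear mtens (syz R j) M -> M} :=
  munit M \o mmap (cval b j) idM.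
(* The Yoneda product is a sum over [j]; apply [b_j (x) M] to [comparison_chain] in each term. *)
have diff_cob := @cob_sum _ _ Q M n 'I_n.+1 (index_enum _) xpredT _
  (fun j _ => cob_post (f j) (comparison_chain (cval a) n j)).
apply: (cob_ext _ diff_cob) => x.
under eq_bigr do rewrite linearB.
rewrite sumrB; congr (_ - _).
transitivity (munit M (mmap (Defs.mulf (cval b) (cval a) n) idM (comparison R Q n x))) => //.
by rewrite mmap_mulf linear_sum.
Qed.

Lemma hh_to_extD (p q : ext R) :
  hh_to_ext Q (p + q) = hh_to_ext Q p + hh_to_ext Q q.
Proof.
rewrite -(ext_reprK p) -(ext_reprK q).
set b := ext_repr p; set a := ext_repr q.
rewrite -[ext_class b + _]/(ext_add _ _) -[RHS]/(ext_add _ _) ext_addE.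
rewrite !hh_to_ext_class ext_addE; apply/ext_classP; apply: eqf_pt => n x.
transitivity (munit M (mmap (cval b n \+ cval a n) idM (comparison R Q n x))) => //.
by rewrite mmapD linearD.
Qed.

(** The identity of [ext Q] detects whether the image of [q] is zero. *)
Lemma annihilatorP (q : ext R) : annihilator R Q q <-> hh_to_ext Q q = 0.
Proof.
split=> [/(_ 1)|q0 theta]; first by rewrite mulr1.
by rewrite q0 mul0r.
Qed.

Lemma annihilator_ideal : two_sided_ideal (annihilator R Q).
Proof.
split=> [|x y /annihilatorP x0 /annihilatorP y0|b x /annihilatorP x0].
- by apply/annihilatorP; exact: (morphD0 hh_to_extD).
- by apply/annihilatorP; rewrite hh_to_extD x0 y0 addr0.
- by split; apply/annihilatorP; rewrite hh_to_extM x0 (mulr0, mul0r).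
Qed.

Lemma annihilator_msplit (r : hrep R) (eta : ext R) :
  represents r eta -> annihilator R Q eta <-> msplit M (alpha r).
Proof.
move=> [a [<- a_r a_off]]; rewrite annihilatorP (msplit_alpha Q) hh_to_ext_class.
split=> [/ext_classP/(_ (hdeg r).+1)|r_cob].
  apply: cob_ext => x; rewrite subr0; congr (munit M _).
  elim/mtens_ind: (comparison _ _ _ x) => [y m|t u IH IH'].
    by rewrite !mmap_pureE a_r.
  by rewrite !linearD IH IH'.
apply/ext_classP => n.
(* The cochain [a] is concentrated in degree [(hdeg r).+1], so the other degrees contribute zero. *)
have [->|n_r] := eqVneq n (hdeg r).+1.
  apply: (cob_ext _ r_cob) => x; rewrite subr0; congr (munit M _).
  elim/mtens_ind: (comparison _ _ _ x) => [y m|t u IH IH'].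
    by rewrite !mmap_pureE a_r.
  by rewrite !linearD IH IH'.
apply: (cob_ext _ (@cob0 _ _ Q _ _)) => x; rewrite subr0.
rewrite -[RHS]/(munit M (mmap (cval a n) idM (comparison R Q n x))).
by rewrite mmap0 ?linear0 // => y; exact: a_off.
Qed.
End Annihilator.

(** * The equivalences and the direct summand *)

Theorem theorem2p3 (k : closedFieldType) (L : falgType k)
    (L_indec : indecomposable L)
    (R : resolution (breg L)) (R_min : minimal R)
    (M : lmodType L) (M_fg : fin_gen M) (Q : resolution M)
    (t : nat) (r : t.-tuple (hrep R)) (eta : 'I_t -> ext R)
    (r_eta : forall i : 'I_t, represents (tnth r i) (eta i)) :
  let part_i := (ideal_gen (range eta) `<=` annihilator R Q)%classic in
  let part_ii := forall i : 'I_t,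
    split_short_exact (mmap (alpha (tnth r i)) (idfun : {linear M -> M}))
                      (mmap (beta (tnth r i)) (idfun : {linear M -> M})) in
  let part_iii :=
    split_short_exact (mmap (alpha_tens r) (idfun : {linear M -> M}))
                      (mmap (beta_tens r) (idfun : {linear M -> M})) in
  [/\ part_i <-> part_ii, part_i <-> part_iii
    & (forall i : 'I_t, annihilator R Q (eta i)) ->
      direct_summand M (mtens (middle_tens r) M)].
Proof.
move=> part_i part_ii part_iii.
have iE : part_i <-> forall i, annihilator R Q (eta i).
  (* Membership in [ideal_gen] is tested on the annihilator, itself a two-sided ideal. *)
  split=> [h i|h q qI]; last by apply: qI (annihilator_ideal R Q) _ => _ [i _ <-].
  by apply: h => I _; apply; exists i.
have iiE : part_ii <-> forall i, msplit M (alpha (tnth r i)).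
  have E i : split_short_exact (mmap (alpha (tnth r i)) (idfun : {linear M -> M}))
      (mmap (beta (tnth r i)) (idfun : {linear M -> M})) <->
      msplit M (alpha (tnth r i)).
    have [ex sj] := mtens_right_exact M (middle_exact (tnth r i)).1 (middle_exact (tnth r i)).2.
    exact: split_exactP.
  by split=> h i; apply/E.
have iiiE : part_iii <-> msplit M (alpha_tens r).
  have [||ex sj] := @mtens_right_exact _ _ _ _ _ M (alpha_tens r) (beta_tens r).
  - move=> y; rewrite -(linear0 (beta_tens r)); split=> [/cok_projP[x xP]|[x <-]].
      by exists x; rewrite -xP subr0.
    by apply/cok_projP; exists x; rewrite subr0.
  - exact: cok_surj.
  exact: split_exactP.
have annE : (forall i, annihilator R Q (eta i)) <->
    forall i, msplit M (alpha (tnth r i)).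
  by split=> h i; apply/(annihilator_msplit Q (r_eta i)).
have tensE : (forall i, msplit M (alpha (tnth r i))) <-> msplit M (alpha_tens r).
  rewrite msplit_alpha_tens; split=> [h q i|h i]; last first.
    by rewrite (tnth_nth (tnth r i)); apply: h; rewrite size_tuple.
  rewrite size_tuple => it; rewrite -(tnth_nth q r (Ordinal it)).
  exact: h.
split; first by rewrite iE annE iiE.
  by rewrite iE annE tensE iiiE.
(* The splitting makes [L (x)_L M] a summand, and [munit_inv] carries this over to [M]. *)
move=> /annE/tensE/iiiE/split_direct_summand.
apply: (direct_summand_iso (i := munit_inv M)).
by exists (munit M); [exact: munit_invK | exact: munitK].
Qed.
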